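(* Fix $m$, $\theta>0$ and a simplex weight vector $\boldsymbol w$. Let $\boldsymbol U=(U_1,\dots,U_m)$ have uniform$(0,1)$ margins and the $m$-variate Clayton copula with parameter $\theta$, and let $H_i=\cot(\pi U_i/2)$. Put $Q_{\boldsymbol w}=\sum_iw_iE_i^{-1/\theta}$, $c=2/\pi$, $d=\pi/6$. Then, as $t\to\infty$, $$\Pr\!\left(\sum_iw_iH_i>t\right)=\frac ct+\begin{cases}c^{1+\theta}D_{\theta,\boldsymbol w}\,t^{-1-\theta}+o(t^{-1-\theta}),&0<\theta<2,\\[3pt]\{c^3D_{2,\boldsymbol w}-a_2\,d\,c^2\,\mathbb E(A_{\boldsymbol w}^2Q_{\boldsymbol w})\}\,t^{-3}+o(t^{-3}),&\theta=2,\\[3pt]-a_\theta\, d\,c^2\,\mathbb E(A_{\boldsymbol w}^2Q_{\boldsymbol w})\,t^{-3}+o(t^{-3}),&\theta>2.\end{cases}$$ The moment $\mathbb E(A_{\boldsymbol w}^2Q_{\boldsymbol w})$ in the last two cases is finite. For one active coordinate (exactly one nonzero weight), the formula reduces to the exact univariate expansion $\Pr(H>t)=c/t-c/(3t^3)+O(t^{-5})$.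
   Context: Simplex weights: $w_i\ge0$, $\sum_iw_i=1$. The $m$-variate Clayton copula is $C_{\theta,m}(u_1,\dots,u_m)=\big(\sum_{i=1}^mu_i^{-\theta}-m+1\big)^{-1/\theta}$. Let $E_1,\dots,E_m$ be i.i.d. $\operatorname{Exp}(1)$ and put $p=1/\theta$, $a_\theta=\Gamma(1+1/\theta)^{-1}$, $b_\theta=(1+\theta)^{-1}$, $A_{\boldsymbol w}=\sum_iw_iE_i^{p}$, $B_{\boldsymbol w}=p\sum_iw_iE_i^{p-1}$, and $D_{\theta,\boldsymbol w}=a_\theta\,\mathbb E[A_{\boldsymbol w}^{\theta}(B_{\boldsymbol w}-b_\theta A_{\boldsymbol w})]$. $H$ denotes a standard positive Half-Cauchy variable, $\Pr(H>x)=\frac2\pi\arctan(1/x)$ for $x>0$. *)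

(* Defs.v *)
From HB Require Import structures.
From mathcomp Require Import all_boot all_order all_algebra.
From mathcomp Require Import all_classical all_reals all_analysis.

Set Implicit Arguments.
Unset Strict Implicit.
Unset Printing Implicit Defensive.

Import Order.TTheory GRing.Theory Num.Theory.
Import numFieldNormedType.Exports.

Local Open Scope classical_set_scope.
Local Open Scope ring_scope.

(* The library declares no such instance, which the notations o_(t \near +oo)
   and O_(t \near +oo) require. *)
Canonical pinfty_nbhs_filter_on (R : numFieldType) :=
  FilterType (pinfty_nbhs R) (@proper_pinfty_nbhs R).

Definition cot {R : realType} (x : R) : R := cos x / sin x.

Definition Gamma {R : realType} (x : R) : R :=
  \int[lebesgue_measure]_(s in `]0, +oo[) (s `^ (x - 1) * expR (- s)).

Definition simplex {R : realType} m (w : 'I_m -> R) : Prop :=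
  (forall i, 0 <= w i) /\ \sum_i w i = 1.

Section RandomVectors.
Context {R : realType} {d : measure_display} {T : measurableType d}.
Context {P : probability T R}.

(* Restricted to measurable sets: the value of a measure outside its
   sigma-algebra is meaningless. *)
Definition has_law (X : {RV P >-> R}) (mu : set R -> \bar R) : Prop :=
  forall B, measurable B -> distribution P X B = mu B.

Definition mutually_independent m (X : 'I_m -> {RV P >-> R}) : Prop :=
  forall (J : {set 'I_m}) (B : 'I_m -> set R),
    (forall i, measurable (B i)) ->
    P [set o | forall i, i \in J -> B i (X i o)]
    = (\prod_(i in J) P (X i @^-1` B i))%E.

Definition iid_exp1 m (X : 'I_m -> {RV P >-> R}) : Prop :=
  mutually_independent X /\ forall i, has_law (X i) (exponential_prob 1).

(* C is a copula of X in the sense of Sklar's theorem. *)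
Definition has_copula m (X : 'I_m -> {RV P >-> R})
    (C : ('I_m -> R) -> R) : Prop :=
  forall x : 'I_m -> R,
    P [set o | forall i, X i o <= x i]
    = (C (fun i => fine (cdf (X i) (x i))))%:E.

Definition half_cauchy (H : {RV P >-> R}) : Prop :=
  forall x : R, 0 < x -> P [set o | x < H o] = (2 / pi * atan (1 / x))%:E.

End RandomVectors.

(* On the faces u_i = 0 the copula is 0, the limit of the formula;
   it must be given separately because 0 `^ (- theta) = 0. *)
Definition clayton {R : realType} (theta : R) m (u : 'I_m -> R) : R :=
  if [forall i, 0 < u i]
  then (\sum_i u i `^ (- theta) - m%:R + 1) `^ (- (1 / theta))
  else 0.

Section Coefficients.
Context {R : realType} {d : measure_display} {T : measurableType d}.
Context {P : probability T R}.
Variables (theta : R) (m : nat) (w : 'I_m -> R) (E : 'I_m -> {RV P >-> R}).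

Definition coef_a : R := (Gamma (1 + 1 / theta))^-1.

Definition coef_b : R := (1 + theta)^-1.

Definition coef_c : R := 2 / pi.

Definition coef_d : R := pi / 6.

Definition A_w (o : T) : R := \sum_i w i * E i o `^ (1 / theta).

Definition B_w (o : T) : R :=
  1 / theta * \sum_i w i * E i o `^ (1 / theta - 1).

Definition Q_w (o : T) : R := \sum_i w i * E i o `^ (- (1 / theta)).

Definition D_integrand (o : T) : R :=
  A_w o `^ theta * (B_w o - coef_b * A_w o).

Definition D_w : R := coef_a * fine 'E_P[D_integrand].

Definition A2Q (o : T) : R := A_w o ^+ 2 * Q_w o.

End Coefficients.

Arguments coef_c {R}.
Arguments coef_d {R}.

Section Tails.
Context {R : realType} {d : measure_display} {T : measurableType d}.
Context {P : probability T R}.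

Definition sum_tail m (w : 'I_m -> R) (U : 'I_m -> {RV P >-> R}) (t : R) : R :=
  fine (P [set o | t < \sum_i w i * cot (pi * U i o / 2)]).

Definition rv_tail (H : {RV P >-> R}) (t : R) : R :=
  fine (P [set o | t < H o]).

End Tails.

(* Main.v *)
(* By the Marshall-Olkin representation, U_i = (1 + E_i / X ^ theta) ^ (-1 / theta)
   with X of density a exp (- x ^ theta), independent of the E_i.  For fixed
   E = e, the weighted sum decreases in the frailty x, so the event that it
   exceeds t is x < x(t), where t x(t) = c A + O(x ^ theta) + O(x ^ 2): the first
   correction comes from the shift of e_i by x ^ theta, the second from
   cot (pi u / 2) = c / u - d u + o(u).  The conditional tail
   a \int_0^x(t) exp (- s ^ theta) ds = a (x(t) - b x(t) ^ (theta + 1) + ...) thus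
   has leading term a c A / t and a correction of order t ^ (-1 - min(theta, 2)).
   Dividing by that order, the remainder is dominated, uniformly in t, by products
   A ^ s * (sum_i w_i E_i ^ q) with s >= 0 and q > -1, whose expectation is finite,
   and dominated convergence integrates the expansion over E. *)
Require Import Defs.
From HB Require Import structures.
From mathcomp Require Import all_boot all_order all_algebra.
From mathcomp Require Import all_classical all_reals all_analysis.
From mathcomp Require Import measurable_realfun ring lra.
Set Implicit Arguments.
Unset Strict Implicit.
Unset Printing Implicit Defensive.
Import Order.TTheory GRing.Theory Num.Theory.
Import numFieldNormedType.Exports.
Local Open Scope classical_set_scope.
Local Open Scope ring_scope.

(** * The cotangent and the arctangent near the origin *)

(** The frailty is taken as [x = V ^ (1 / theta)], not as the Gamma variable [V] itself: its density
    is bounded at the origin, and the conditional tail becomes a plain integral over []0, x(t)[].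
    The obstacle is a dominating function that is integrable for every [theta]. Negative powers of
    the [E_i] are unavoidable, and only exponents above -1 have finite mean. The shift of [e_i]
    costs [e_i ^ (1 / theta - 1)], which is always admissible; the cotangent correction naturally
    costs [e_i ^ (- 1 / theta)], which is admissible only for [theta > 1]. Below [theta = 2] it is
    therefore bounded by the quantity that bounds the shift. The vectors [U] and [E] live on
    unrelated probability spaces, and the copula fixes only the joint distribution function of [U].
    The event about the weighted sum is carried to the product of the space of [E] with the frailty
    line by uniqueness of measures on a pi-system. *)

Section Trigonometry.
Context {R : realType}.
Implicit Types x y u : R.

Lemma mean_value0 (f df : R -> R) x : 0 < x ->
  (forall y, is_derive y 1 f (df y)) ->
  exists2 c, 0 < c < x & f x - f 0 = df c * x.
Proof.
move=> x0 fdf; have [|c] := @MVT R f df 0 x x0 (fun y _ => fdf y).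
- by apply: derivable_within_continuous => y _; case: (fdf y).
- by rewrite in_itv/= subr0 => c0x ->; exists c.
Qed.

(** Iterating this yields the alternating Taylor bounds below: the derivative of each difference is
    nonnegative by an earlier bound, starting from [cos <= 1]. *)
Lemma nonneg_derive_ge0 (f df : R -> R) x : 0 <= x ->
  (forall y, is_derive y 1 f (df y)) -> f 0 = 0 ->
  (forall y, 0 < y < x -> 0 <= df y) -> 0 <= f x.
Proof.
rewrite le_eqVlt => /predU1P[<- _ -> //|x0] fdf f0 df_ge0.
have [c cx] := mean_value0 x0 fdf; rewrite f0 subr0 => ->.
by rewrite mulr_ge0 ?df_ge0// ltW.
Qed.

Lemma sin_le x : 0 <= x -> sin x <= x.
Proof.
move=> x0; rewrite -subr_ge0.
apply: (@nonneg_derive_ge0 (fun x => x - sin x) (fun x => 1 - cos x)) => //.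
by rewrite sin0 subrr.
Qed.

Lemma cos_ge x : 0 <= x -> 1 - x ^+ 2 / 2 <= cos x.
Proof.
move=> x0; rewrite -subr_ge0.
apply: (@nonneg_derive_ge0 (fun x => cos x - (1 - x ^+ 2 / 2))
  (fun x => x - sin x)) => //.
- by move=> y; apply: is_derive_eq; rewrite /GRing.scale/=; field.
- by rewrite cos0 expr0n/= mul0r subr0 subrr.
- by move=> y /andP[y0 _]; rewrite subr_ge0 sin_le// ltW.
Qed.

Lemma sin_ge x : 0 <= x -> x - x ^+ 3 / 6 <= sin x.
Proof.
move=> x0; rewrite -subr_ge0.
apply: (@nonneg_derive_ge0 (fun x => sin x - (x - x ^+ 3 / 6))
  (fun x => cos x - (1 - x ^+ 2 / 2))) => //.
- by move=> y; apply: is_derive_eq; rewrite /GRing.scale/=; field.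
- by rewrite sin0 expr0n/= mul0r subr0 subrr.
- by move=> y /andP[y0 _]; rewrite subr_ge0 cos_ge// ltW.
Qed.

Lemma sin_sub_mul_cos_le x : 0 <= x -> sin x - x * cos x <= x ^+ 3 / 3.
Proof.
move=> x0; rewrite -subr_ge0.
apply: (@nonneg_derive_ge0 (fun x => x ^+ 3 / 3 - (sin x - x * cos x))
  (fun x => x * (x - sin x))) => //.
- by move=> y; apply: is_derive_eq; rewrite /GRing.scale/=; field.
- by rewrite sin0 expr0n/= !mul0r subr0 subrr.
- by move=> y /andP[/ltW y0 _]; rewrite mulr_ge0// subr_ge0 sin_le.
Qed.

Lemma sin_sub_mul_cos_ge x : 0 <= x ->
  x ^+ 3 / 3 - x ^+ 5 / 30 <= sin x - x * cos x.
Proof.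
move=> x0; rewrite -subr_ge0.
apply: (@nonneg_derive_ge0
  (fun x => (sin x - x * cos x) - (x ^+ 3 / 3 - x ^+ 5 / 30))
  (fun x => x * (sin x - (x - x ^+ 3 / 6)))) => //.
- by move=> y; apply: is_derive_eq; rewrite /GRing.scale/=; field.
- by rewrite sin0 !expr0n/= !mul0r subr0 subrr.
- by move=> y /andP[/ltW y0 _]; rewrite mulr_ge0// subr_ge0 sin_ge.
Qed.

Lemma inv_sub_cot x : 0 < x < pi ->
  x^-1 - cot x = (sin x - x * cos x) / (x * sin x).
Proof.
move=> /andP[x0 xpi]; rewrite /cot.
have s0 : 0 < sin x by rewrite sin_gt0_pi// x0.
by field; rewrite (gt_eqF x0) (gt_eqF s0).
Qed.

(** The numerator [sin x - x cos x] is [x ^ 3 / 3] up to fifth order, and the denominator [x sin x]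
    lies between [x ^ 2 - x ^ 4 / 6] and [x ^ 2]. Both bounds are [x / 3] to first order, and
    [x = pi u / 2] turns this into [coef_d * u]. *)
Lemma inv_sub_cot_bounds x : 0 < x <= 2 -> x < pi ->
  x / 3 * (1 - x ^+ 2 / 10) <= x^-1 - cot x <= x / 3 / (1 - x ^+ 2 / 6).
Proof.
move=> /andP[x0 x2] xpi; rewrite inv_sub_cot ?x0//.
have s0 : 0 < sin x by rewrite sin_gt0_pi// x0.
have q0 : 0 < 1 - x ^+ 2 / 6 by nra.
have xs0 : 0 < x * sin x by rewrite mulr_gt0.
have xs : x * sin x <= x ^+ 2 by rewrite expr2 ler_wpM2l ?sin_le// ltW.
have := sin_ge (ltW x0); have := sin_sub_mul_cos_ge (ltW x0).
have := sin_sub_mul_cos_le (ltW x0) => h1 h2 h3.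
apply/andP; split.
- rewrite ler_pdivlMr//; apply: le_trans h2.
  have -> : x ^+ 3 / 3 - x ^+ 5 / 30 = x / 3 * (1 - x ^+ 2 / 10) * x ^+ 2.
    by field.
  by rewrite ler_wpM2l// mulr_ge0//; nra.
- rewrite ler_pdivrMr//; apply: (le_trans h1).
  rewrite [leRHS]mulrAC ler_pdivlMr//.
  have -> : x ^+ 3 / 3 * (1 - x ^+ 2 / 6) = x / 3 * (x * (x - x ^+ 3 / 6)).
    by field.
  by rewrite !ler_wpM2l// ?(ltW x0)// mulr_ge0// ltW.
Qed.

Lemma cot_decr x y : 0 < x -> x < y -> y < pi -> cot y < cot x.
Proof.
move=> x0 xy ypi; rewrite /cot -subr_gt0.
have sx : 0 < sin x by rewrite sin_gt0_pi// x0 (lt_trans xy).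
have sy : 0 < sin y by rewrite sin_gt0_pi// ypi (lt_trans x0).
have -> : cos x / sin x - cos y / sin y = sin (y - x) / (sin x * sin y).
  by rewrite sinB; field; rewrite (gt_eqF sx) (gt_eqF sy).
by rewrite divr_gt0 ?mulr_gt0// sin_gt0_pi// subr_gt0 xy/= ltrBlDr ltr_wpDr// ltW.
Qed.

Lemma continuous_cot x : 0 < x < pi -> {for x, continuous cot}.
Proof.
move=> xpi; apply: cvgM; first exact: continuous_cos.
by apply: cvgV; [rewrite gt_eqF// sin_gt0_pi|exact: continuous_sin].
Qed.

(* The amount by which the Half-Cauchy quantile falls short of its Pareto
   approximation; it produces the [t ^ -3] term of the expansion. *)
Definition cot_defect u : R := coef_c / u - cot (pi * u / 2).

Lemma half_angle u : 0 < u <= 1 -> 0 < pi * u / 2 <= 2 /\ pi * u / 2 < pi.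
Proof.
move=> /andP[u0 u1]; have [p0 p1 p2] : [/\ 0 < (pi : R), 2 <= (pi : R) & pi <= 4 :> R].
  split; [exact: pi_gt0|exact: pi_ge2|].
  by have [/andP[_ ? _]] := @pihalf_02_cos_pihalf R; lra.
split; last nra.
by apply/andP; split; [rewrite divr_gt0// mulr_gt0|nra].
Qed.

Lemma cot_defectE u : 0 < u ->
  cot_defect u = (pi * u / 2)^-1 - cot (pi * u / 2).
Proof.
move=> u0; rewrite /cot_defect /coef_c; congr (_ - _).
have p0 : pi != 0 :> R by rewrite gt_eqF// pi_gt0.
have v0 : u != 0 by rewrite gt_eqF.
by move: pi p0 => q q0; field; rewrite v0 q0.
Qed.

(** Since [x <= 2] gives [1 - x ^ 2 / 6 >= 1 / 3], the defect is at most [x = pi u / 2]; the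
    constant 4 is generous. This serves the domination, while [cot_defect_cvg] supplies the exact
    rate. *)
Lemma cot_defect_bounds u : 0 < u <= 1 -> 0 <= cot_defect u <= 4 * u.
Proof.
move=> u01; have [x02 xpi] := half_angle u01; have /andP[u0 u1] := u01.
rewrite cot_defectE//; set x := pi * u / 2 in x02 xpi *.
have /andP[l r] := inv_sub_cot_bounds x02 xpi.
have /andP[x0 x2] := x02.
apply/andP; split; first by apply: le_trans l; nra.
have q3 : (1 - x ^+ 2 / 6)^-1 <= 3.
  by rewrite invf_ple ?posrE//; nra.
apply: (le_trans r); apply: (@le_trans _ _ (x / 3 * 3)).
  by rewrite ler_wpM2l//; nra.
have : pi <= 4 :> R by have [/andP[_ ? _]] := @pihalf_02_cos_pihalf R; lra.
by rewrite /x; nra.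
Qed.

Lemma cot_defect_cvg : cot_defect u / u @[u --> 0^'+] --> (coef_d : R).
Proof.
have p0 := @pi_gt0 R.
pose x u : R := pi * u / 2.
have x_cvg : x u @[u --> 0^'+] --> (0 : R).
  apply: cvg_at_right_filter; rewrite -[X in _ --> X](_ : pi * 0 / 2 = 0 :> R); last by rewrite mulr0 mul0r.
  by apply: cvgMl; apply: cvgMr; exact: cvg_id.
have l_cvg : coef_d * (1 - x u ^+ 2 / 10) @[u --> 0^'+] --> (coef_d : R).
  rewrite -[X in _ --> X](_ : coef_d * (1 - 0 ^+ 2 / 10) = coef_d :> R); last first.
    by rewrite expr0n/= mul0r subr0 mulr1.
  apply: cvgMr; apply: cvgB; first exact: cvg_cst.
  by apply: cvgMl; under eq_cvg do rewrite expr2; rewrite expr2; apply: cvgM.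
have r_cvg : coef_d / (1 - x u ^+ 2 / 6) @[u --> 0^'+] --> (coef_d : R).
  rewrite -[X in _ --> X](_ : coef_d / (1 - 0 ^+ 2 / 6) = coef_d :> R); last first.
    by rewrite expr0n/= mul0r subr0 invr1 mulr1.
  apply: cvgMr; apply: cvgV; first by rewrite expr0n/= mul0r subr0 oner_eq0.
  apply: cvgB; first exact: cvg_cst.
  by apply: cvgMl; under eq_cvg do rewrite expr2; rewrite expr2; apply: cvgM.
apply: squeeze_cvgr l_cvg r_cvg; near=> u.
have u0 : 0 < u by near: u; exact: nbhs_right_gt.
have u1 : u <= 1 by near: u; apply: nbhs_right_le.
have [x02 xpi] := half_angle (introT andP (conj u0 u1)).
have /andP[l r] := inv_sub_cot_bounds x02 xpi.
rewrite cot_defectE// ler_pdivlMr// ler_pdivrMr//.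
have e : coef_d * u = pi * u / 2 / 3 by rewrite /coef_d; field.
by apply/andP; split; [rewrite [leLHS]mulrAC e|rewrite [leRHS]mulrAC e].
Unshelve. all: by end_near. Qed.

(** The remainder has derivative [x ^ 4 / (1 + x ^ 2)], between 0 and [x ^ 4]; the mean value
    theorem contributes one more factor [x]. *)
Lemma atan_taylor3 x : 0 <= x -> `|atan x - (x - x ^+ 3 / 3)| <= x ^+ 5.
Proof.
rewrite le_eqVlt => /predU1P[<-|x0].
  by rewrite atan0 !expr0n/= mul0r !subr0 normr0.
have [y|c /andP[c0 cx]] := @mean_value0 (fun x => atan x - (x - x ^+ 3 / 3))
  (fun x => x ^+ 4 / (1 + x ^+ 2)) x x0.
  apply: is_derive_eq; rewrite /GRing.scale/=.
  have h : 1 + y ^+ 2 != 0 by rewrite gt_eqF// ltr_pwDl// sqr_ge0.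
  by field.
rewrite atan0 expr0n/= mul0r subr0 subrr subr0 => ->.
have c2 : 0 <= c ^+ 2 by rewrite sqr_ge0.
rewrite ger0_norm; last by rewrite !mulr_ge0 ?invr_ge0 ?exprn_ge0 ?ltW//; lra.
rewrite [leRHS]exprSr ler_wpM2r ?(ltW x0)// ler_pdivrMr; last lra.
apply: (@le_trans _ _ (x ^+ 4)); first by rewrite lerXn2r// ?nnegrE ltW.
by rewrite ler_peMr ?exprn_ge0 ?(ltW x0)//; lra.
Qed.

End Trigonometry.

(** * Exponential moments and the Gamma function *)

Section Density.
Context d (T : measurableType d) (R : realType).
Local Open Scope ereal_scope.

(** [nu] is absolutely continuous with respect to [mu], and its Radon-Nikodym derivative has the
    same integral as [g] on every measurable set, hence equals [g] almost everywhere. *)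
Lemma integral_density (nu : {finite_measure set T -> \bar R})
    (mu : {sigma_finite_measure set T -> \bar R}) (g : T -> R) (f : T -> \bar R) :
  measurable_fun setT g -> (forall x, 0 <= g x)%R ->
  (forall B, measurable B -> nu B = \int[mu]_(x in B) (g x)%:E) ->
  measurable_fun setT f -> (forall x, 0 <= f x) ->
  \int[nu]_x f x = \int[mu]_x (f x * (g x)%:E).
Proof.
move=> mg g0 nuE mf f0.
have numu : nu `<< mu.
  apply/null_content_dominatesP => A mA muA.
  by rewrite nuE// null_set_integral//; apply/measurable_funTS/measurable_EFinP.
rewrite -(Radon_Nikodym_SigmaFinite.change_of_variables numu)//.
have mRN := measurable_int _ (Radon_Nikodym_SigmaFinite.f_integrable numu).
apply: ge0_ae_eq_integral => //.
- exact: emeasurable_funM.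
- by apply: emeasurable_funM => //; exact/measurable_EFinP.
- by move=> x _; rewrite mule_ge0// Radon_Nikodym_SigmaFinite.f_ge0.
- by move=> x _; rewrite mule_ge0// lee_fin.
- apply: ae_eqe_mul2l; apply: integral_ae_eq => //.
  + exact: Radon_Nikodym_SigmaFinite.f_integrable.
  + exact/measurable_EFinP.
  + by move=> E _ mE; rewrite -Radon_Nikodym_SigmaFinite.f_integral// nuE.
Qed.

End Density.

Section PowerIntegral.
Context {R : realType}.
Local Notation mu := (@lebesgue_measure R).
Implicit Types q x y s : R.

Lemma integral_powR_itv q x y : -1 < q -> 0 < x -> x < y ->
  (\int[mu]_(s in `[x, y]) (s `^ q)%:E =
   ((y `^ (q + 1) - x `^ (q + 1)) / (q + 1))%:E)%E.
Proof.
move=> q1 x0 xy.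
have q1n0 : q + 1 != 0 by rewrite gt_eqF// -ltrBlDr sub0r.
pose F (s : R) := (q + 1)^-1 * s `^ (q + 1).
have dF (s : R) : 0 < s -> is_derive s 1 F (s `^ q).
  move=> s0; have := @is_derive1_powR R (q + 1) s s0 => h.
  by apply: is_derive_eq; rewrite /GRing.scale/= mulKf// addrK.
have cF (s : R) : 0 < s -> {for s, continuous F}.
  by move=> s0; apply/differentiable_continuous/derivable1_diffP; case: (dF _ s0).
rewrite mulrBl EFinB ![_ / (q + 1)]mulrC.
apply: (@continuous_FTC2 _ _ F) => //.
- apply: derivable_within_continuous => s; rewrite in_itv/= => /andP[xs _].
  by case: (@is_derive1_powR R q s (lt_le_trans x0 xs)).
- split.
  + by move=> s; rewrite in_itv/= => /andP[xs _]; case: (dF _ (lt_trans x0 xs)).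
  + by apply: cvg_at_right_filter; exact: cF.
  + by apply: cvg_at_left_filter; apply: cF; exact: lt_trans xy.
- move=> s; rewrite in_itv/= => /andP[xs _].
  by rewrite derive1E; case: (dF _ (lt_trans x0 xs)).
Qed.

(** For [q < 0] the integrand is singular at the origin, so the fundamental theorem is applied on
    [[x / (n + 2), x]] and monotone convergence lets the left end tend to 0. *)
Lemma integral_powR0 q x : -1 < q -> 0 < x ->
  (\int[mu]_(s in `]0%R, x[) (s `^ q)%:E = (x `^ (q + 1) / (q + 1))%:E)%E.
Proof.
move=> q1 x0.
have q10 : 0 < q + 1 by rewrite -ltrBlDr sub0r.
have mp D : measurable_fun D (fun s : R => (s `^ q)%:E).
  by apply/measurable_funTS/measurable_EFinP; exact: measurable_powR.
rewrite integral_itv_bndo_bndc//.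
(* The shift by 2 keeps [e 0 < x], so that every interval is nondegenerate. *)
pose e n : R := x / n.+2%:R.
have e0 n : 0 < e n by rewrite divr_gt0.
have ex n : e n < x by rewrite ltr_pdivrMr// ltr_pMr// ltr1n.
have eq0 : \bigcup_n `[e n, x]%classic = `]0, x]%classic.
  apply/seteqP; split => s/=.
    by move=> [n _]/=; rewrite !in_itv/= => /andP[/(lt_le_trans (e0 n)) ->].
  rewrite in_itv/= => /andP[s0 sx].
  exists (Num.truncn (x / s)) => //=; rewrite in_itv/= sx andbT.
  rewrite /e ler_pdivrMr// mulrC -ler_pdivrMr//.
  by rewrite (le_trans (ltW (truncnS_gt _)))// ler_nat.
have h : (\int[mu]_(s in `[e i, x]) (s `^ q)%:E)%E @[i --> \oo] -->
    (\int[mu]_(s in `]0%R, x]) (s `^ q)%:E)%E.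
  rewrite -eq0; apply: ge0_nondecreasing_set_cvg_integral => //.
  - move=> m n mn; apply/subsetPset; apply: subset_itvr.
    by rewrite bnd_simp ler_pM2l// lef_pV2// ?posrE// ler_nat.
  - by move=> i; exact: mp.
  - by move=> i s _; rewrite lee_fin powR_ge0.
have e_cvg : e n `^ (q + 1) @[n --> \oo] --> (0 : R).
  rewrite (_ : (fun n => _) = fun n => x `^ (q + 1) * n.+2%:R^-1 `^ (q + 1)).
    2: by apply/funext => n; rewrite powRM ?(ltW x0)// invr_ge0.
  rewrite -[X in _ --> X](mulr0 (x `^ (q + 1))).
  apply: cvgM; first exact: cvg_cst.
  apply: ((cvg_at_rightP (fun y : R => y `^ (q + 1)) 0 0).1 (powR_cvg0 q10)).
  split; first by move=> n; rewrite invr_gt0.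
  have := @cvg_harmonic R; rewrite -(cvg_shiftS (@harmonic R)); exact.
apply/esym; apply: cvg_unique h => //.
rewrite (_ : (fun i => _) = (fun i => ((x `^ (q + 1) - e i `^ (q + 1)) / (q + 1))%:E)); last first.
  by apply/funext => i; rewrite integral_powR_itv.
apply: cvg_EFin; first exact: nearW.
have -> : x `^ (q + 1) / (q + 1) = (x `^ (q + 1) - 0) / (q + 1) by rewrite subr0.
by apply: cvgMl; apply: cvgB; [exact: cvg_cst|exact: e_cvg].
Qed.

Lemma integral_expRN s :
  (\int[mu]_(y in `]s, +oo[) (expR (- y))%:E = (expR (- s))%:E)%E.
Proof.
have dE (y : R) : is_derive y 1 (fun y => - expR (- y)) (expR (- y)).
  by apply: is_derive_eq; rewrite /GRing.scale/=; ring.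
have cE : continuous (fun y : R => expR (- y)).
  by move=> y; apply: continuous_comp; [exact: opp_continuous|exact: continuous_expR].
rewrite integral_itv_obnd_cbnd; last first.
  by apply/measurable_funTS/measurable_EFinP/measurableT_comp.
rewrite (@ge0_continuous_FTC2y _ _ (fun y => - expR (- y)) _ 0)//.
- by rewrite -EFinN opprK add0e.
- exact: continuous_subspaceT.
- by rewrite -oppr0; apply: cvgN; exact: cvgr_expR.
- by apply: cvg_at_right_filter; apply: cvgN; exact: cE.
- by move=> y _; rewrite derive1E; case: (dE y).
Qed.

End PowerIntegral.

Section LayerCake.
Context {R : realType}.
Local Notation mu := (@lebesgue_measure R).
Implicit Types q x y s : R.

(* Writing [e ^ (- hinv s)] as the exponential mass beyond [hinv s] turns a
   one-dimensional integral into a double one over [s < h y]. *)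
Lemma exponential_layer_cake (k h hinv : R -> R) :
  measurable_fun setT k -> (forall s, 0 < s -> 0 <= k s) ->
  measurable_fun setT h ->
  (forall s, 0 < s -> 0 <= hinv s) ->
  (forall s y, 0 < s -> 0 < y -> (s < h y) = (hinv s < y)) ->
  (\int[mu]_(y in `]0%R, +oo[)
     (\int[mu]_(s in `]0%R, h y[) (k s)%:E * (expR (- y))%:E) =
   \int[mu]_(s in `]0%R, +oo[) ((k s)%:E * (expR (- hinv s))%:E))%E.
Proof.
move=> mk k0 mh hinv0 hE.
pose b (z : R * R) := [&& 0 < z.1, 0 < z.2 & z.2 < h z.1].
pose f (z : R * R) : R := if b z then k z.2 * expR (- z.1) else 0.
have mf : measurable_fun setT f.
  apply: measurable_fun_ifT => //.
  - apply: measurable_and; last apply: measurable_and.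
    + exact: measurable_fun_ltr.
    + exact: measurable_fun_ltr.
    + by apply: measurable_fun_ltr => //; exact: measurableT_comp.
  - apply: measurable_funM; first exact: measurableT_comp.
    by apply: measurableT_comp => //; exact: measurableT_comp.
have f0 z : 0 <= f z.
  rewrite /f; case: ifPn => // /and3P[_ z0 _].
  by rewrite mulr_ge0 ?expR_ge0 ?k0.
have mfE : measurable_fun setT (EFin \o f) by exact/measurable_EFinP.
have fE0 z : (0 <= (EFin \o f) z)%E by rewrite lee_fin.
have mkD D : measurable_fun D (fun s => (k s)%:E).
  by apply/measurable_funTS/measurable_EFinP.
have mexp D : measurable_fun D (fun y : R => (expR (- y))%:E).
  by apply/measurable_funTS/measurable_EFinP/measurableT_comp.
transitivity (\int[mu]_y \int[mu]_s (EFin \o f) (y, s))%E.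
  rewrite integral_mkcond; apply: eq_integral => y _; rewrite patchE.
  case: ifPn => [|ny]; last first.
    rewrite integral0_eq// => s _ /=; rewrite /f /b /=.
    by rewrite ifF//; apply: contraNF ny => /andP[y0 _]; rewrite inE/= in_itv/= y0.
  rewrite inE/= in_itv/= andbT => y0.
  rewrite -ge0_integralZr//; last 2 first.
    exact: mkD.
    by move=> s /=; rewrite in_itv/= lee_fin => /andP[/k0].
  rewrite integral_mkcond; apply: eq_integral => s _.
  rewrite patchE /f /b /= y0/=.
  by rewrite mem_setE in_itv/=; case: ifP.
rewrite (@fubini_tonelli _ _ _ _ _ mu mu (EFin \o f) mfE fE0).
rewrite [RHS]integral_mkcond; apply: eq_integral => s _; rewrite patchE.
case: ifPn => [|ns]; last first.
  rewrite integral0_eq// => y _ /=; rewrite /f /b /=.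
  by rewrite ifF//; apply: contraNF ns => /and3P[_ s0 _]; rewrite inE/= in_itv/= s0.
rewrite inE/= in_itv/= andbT => s0.
rewrite -integral_expRN -ge0_integralZl//; last 2 first.
- exact: mexp.
- by rewrite lee_fin k0.
rewrite [RHS]integral_mkcond; apply: eq_integral => y _.
rewrite patchE /f /b /= s0/= mem_setE in_itv/= andbT.
have [y0|y0] := ltP 0 y; first by rewrite /= hE//; case: ifP.
by rewrite /= ltNge (le_trans y0 (hinv0 _ s0)).
Qed.

End LayerCake.

Section ExponentialMoments.
Context {R : realType}.
Local Notation mu := (@lebesgue_measure R).
Implicit Types p q x y s theta lambda : R.

(** This is [Gamma (1 + q)] as an extended real, so that it can be manipulated before its finiteness
    is known. *)
Definition exp_moment q : \bar R :=
  (\int[mu]_(y in `]0%R, +oo[) (y `^ q * expR (- y))%:E)%E.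

Lemma exp_moment_ge0 q : (0 <= exp_moment q)%E.
Proof.
by apply: integral_ge0 => y _; rewrite lee_fin mulr_ge0 ?powR_ge0 ?expR_ge0.
Qed.

Lemma measurable_exp_moment q (D : set R) :
  measurable_fun D (fun y => (y `^ q * expR (- y))%:E).
Proof.
apply/measurable_funTS/measurable_EFinP; apply: measurable_funM.
  exact: measurable_powR.
exact: measurableT_comp.
Qed.

(** The functional equation of Gamma, without integration by parts: [y ^ (q + 1)] is [q + 1] times
    the integral of [s ^ q] over []0, y[], and the layer cake with [h = id] exchanges the two
    integrals. *)
Lemma exp_momentS q : -1 < q -> (exp_moment (q + 1) = (q + 1)%:E * exp_moment q)%E.
Proof.
move=> q1; have q10 : 0 < q + 1 by rewrite -ltrBlDr sub0r.
have h : (\int[mu]_(y in `]0%R, +oo[)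
     (\int[mu]_(s in `]0%R, y[) (s `^ q)%:E * (expR (- y))%:E) =
   \int[mu]_(s in `]0%R, +oo[) ((s `^ q)%:E * (expR (- s))%:E))%E.
  apply: (@exponential_layer_cake R (fun s => s `^ q) id id) => //.
  - by move=> s _; exact: powR_ge0.
  - by move=> s /ltW.
rewrite /exp_moment.
under [in RHS]eq_integral do rewrite EFinM.
rewrite -h [X in (_ = _ * X)%E](_ : _ = ((q + 1)^-1%:E * exp_moment (q + 1))%E).
  by rewrite muleA -EFinM mulfV ?gt_eqF// mul1e.
rewrite /exp_moment -ge0_integralZl//; last 3 first.
- exact: measurable_exp_moment.
- by move=> y _; rewrite lee_fin mulr_ge0 ?powR_ge0 ?expR_ge0.
- by rewrite lee_fin invr_ge0 ltW.
apply: eq_integral => y; rewrite inE/= in_itv/= andbT => y0.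
by rewrite integral_powR0// -!EFinM mulrAC mulrC.
Qed.

Lemma exp_moment0 : exp_moment 0 = 1%E.
Proof.
rewrite /exp_moment; under eq_integral do rewrite powRr0 mul1r.
by rewrite integral_expRN oppr0 expR0.
Qed.

Lemma exp_moment_nat n : (exp_moment n%:R < +oo)%E.
Proof.
elim: n => [|n IH]; first by rewrite exp_moment0 ltry.
rewrite -natr1 exp_momentS; last by rewrite (lt_le_trans _ (ler0n _ _))// ltrN10.
by rewrite lte_mul_pinfty// lee_fin -natr1 addr_ge0.
Qed.

(** For [p >= 0], [y ^ p <= 1 + y ^ n] with an integer [n > p]. For [-1 < q < 0] the functional
    equation is read backwards: an infinite moment of order [q] would make the one of order [q + 1]
    infinite. *)
Lemma exp_moment_lty q : -1 < q -> (exp_moment q < +oo)%E.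
Proof.
have H p : 0 <= p -> (exp_moment p < +oo)%E.
  move=> p0; pose n := (Num.truncn p).+1.
  apply: (@le_lt_trans _ _ (exp_moment 0 + exp_moment n%:R)%E).
    rewrite -ge0_integralD//=.
    - apply: ge0_le_integral => //=.
      + by move=> y _; rewrite lee_fin mulr_ge0 ?powR_ge0 ?expR_ge0.
      + exact: measurable_exp_moment.
      + by apply: emeasurable_funD; exact: measurable_exp_moment.
      + move=> y; rewrite /= in_itv/= andbT => y0.
        rewrite lee_fin -mulrDl ler_wpM2r ?expR_ge0// powRr0.
        have [y1|y1] := leP y 1.
          rewrite (le_trans (@ger_powR _ y _ 0 p _)) ?y0 ?powRr0 ?lerDl ?powR_ge0//.
        rewrite (@le_trans _ _ (y `^ n%:R))// ?lerDr// ler_powR ?(ltW y1)//.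
        by rewrite /n ltW// truncnS_gt.
    - by move=> y _; rewrite lee_fin mulr_ge0 ?powR_ge0 ?expR_ge0.
    - exact: measurable_exp_moment.
    - by move=> y _; rewrite lee_fin mulr_ge0 ?powR_ge0 ?expR_ge0.
    - exact: measurable_exp_moment.
  by apply: lte_add_pinfty; [rewrite exp_moment0 ltry|exact: exp_moment_nat].
move=> q1; have [/H//|q0] := leP 0 q.
have q10 : 0 < q + 1 by rewrite -ltrBlDr sub0r.
have := H (q + 1) (ltW q10); rewrite exp_momentS//.
move: (exp_moment_ge0 q); case: (exp_moment q) => // [r _ _|_].
  by rewrite ltry.
by rewrite gt0_muley ?ltxx// lte_fin.
Qed.

Lemma exp_moment_fin q : -1 < q -> exp_moment q \is a fin_num.
Proof. by move=> q1; rewrite ge0_fin_numE ?exp_moment_ge0// exp_moment_lty. Qed.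

Lemma GammaE p : -1 < p -> exp_moment p = (Gamma (1 + p))%:E.
Proof.
move=> p1; rewrite /Gamma /Rintegral.
have -> : 1 + p - 1 = p by ring.
by rewrite fineK//; exact: exp_moment_fin.
Qed.

Lemma Gamma_gt0 p : 0 < p -> 0 < Gamma (1 + p).
Proof.
move=> p0; rewrite -lte_fin -GammaE ?(lt_trans _ p0)//.
apply: (@lt_le_trans _ _ (expR (- 1))%:E); first by rewrite lte_fin expR_gt0.
rewrite -integral_expRN.
apply: (@le_trans _ _ (\int[mu]_(y in `]1%R, +oo[) (y `^ p * expR (- y))%:E)%E).
- apply: ge0_le_integral => //=.
  + by apply/measurable_funTS/measurable_EFinP; exact: measurableT_comp.
  + exact: measurable_exp_moment.
  + move=> y; rewrite /= in_itv/= andbT => y1; rewrite lee_fin.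
    rewrite ler_peMl ?expR_ge0// -(powRr0 y) ler_powR// ltW//.
- apply: ge0_subset_integral => //=.
  + exact: measurable_exp_moment.
  + by move=> y _; rewrite lee_fin mulr_ge0 ?powR_ge0 ?expR_ge0.
  + by apply: subset_itvr; rewrite bnd_simp.
Qed.

(* The Laplace transform identity behind the Clayton copula. *)
Lemma stretched_exp_integral theta lambda : 0 < theta -> 0 < lambda ->
  (\int[mu]_(x in `]0%R, +oo[) (expR (- (lambda * x `^ theta)))%:E =
   (lambda `^ (- (1 / theta)) * Gamma (1 + 1 / theta))%:E)%E.
Proof.
move=> t0 l0.
have p0 : 0 < 1 / theta by rewrite divr_gt0.
have tp : theta * (1 / theta) = 1 by rewrite mul1r mulfV// gt_eqF.
have pt : 1 / theta * theta = 1 by rewrite mulrC.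
(* With [k = 1] the inner integral is the length [(y / lambda) ^ (1 / theta)], so exchanging the
   integrals replaces the substitution [y = lambda x ^ theta]. *)
have h : (\int[mu]_(y in `]0%R, +oo[)
     (\int[mu]_(s in `]0%R, ((y / lambda) `^ (1 / theta))%R[) (1 : R)%:E * (expR (- y))%:E) =
   \int[mu]_(s in `]0%R, +oo[) ((1 : R)%:E * (expR (- (lambda * s `^ theta)))%:E))%E.
apply: (@exponential_layer_cake R (fun=> 1)
  (fun y => (y / lambda) `^ (1 / theta)) (fun x => lambda * x `^ theta)).
- exact: measurable_cst.
- by move=> s _; exact: ler01.
- apply: (measurableT_comp (measurable_powR (1 / theta))).
  exact: measurable_funM.
- by move=> s s0; rewrite mulr_ge0 ?powR_ge0// ltW.
- move=> s y s0 y0.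
  have yl0 : 0 < y / lambda by rewrite divr_gt0.
  have -> : (lambda * s `^ theta < y) = (s `^ theta < y / lambda).
    by rewrite ltr_pdivlMr// mulrC.
  apply/idP/idP => h.
  + have := @gt0_ltr_powR R theta t0 _ _ _ _ h.
    rewrite -powRrM pt powRr1 ?(ltW yl0)//.
    by apply; rewrite nnegrE// ?powR_ge0// ltW.
  + have := @gt0_ltr_powR R (1 / theta) p0 _ _ _ _ h.
    rewrite -powRrM tp powRr1 ?(ltW s0)//.
    by apply; rewrite nnegrE// ?powR_ge0// ltW.
under eq_integral do rewrite -[X in X%:E]mul1r EFinM.
rewrite -h EFinM -GammaE ?(lt_trans _ p0)// /exp_moment -ge0_integralZl//.
- apply: eq_integral => y; rewrite inE/= in_itv/= andbT => y0.
  rewrite integral_cst//= lebesgue_measure_itv/= lte_fin.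
  have yl0 : 0 < (y / lambda) `^ (1 / theta) by rewrite powR_gt0// divr_gt0.
  rewrite yl0 -EFinD -!EFinM mul1r subr0 mulrA; congr (_ * _)%:E.
  have lE : lambda^-1 `^ theta^-1 = lambda `^ (- theta^-1).
    by rewrite -powR_inv1 ?(ltW l0)// -powRrM mulN1r.
  by rewrite powRM ?(ltW y0) ?invr_ge0 ?(ltW l0)// lE !mul1r mulrC.
- exact: measurable_exp_moment.
- by move=> y _; rewrite lee_fin mulr_ge0 ?powR_ge0 ?expR_ge0.
- by rewrite lee_fin powR_ge0.
Qed.

End ExponentialMoments.

Section ExponentialLaw.
Context {R : realType} d (T : measurableType d) (P : probability T R).
Variable Y : {RV P >-> R}.
Hypothesis Y_exp : has_law Y (exponential_prob 1).
Local Notation mu := (@lebesgue_measure R).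

Lemma exp_law_integral (f : R -> R) : measurable_fun setT f ->
  (forall y, 0 <= f y) ->
  (\int[P]_o (f (Y o))%:E = \int[mu]_(y in `]0%R, +oo[) (f y * expR (- y))%:E)%E.
Proof.
move=> mf f0.
have mfE : @measurable_fun _ _ (measurableTypeR R) _ setT (EFin \o f).
  exact/measurable_EFinP.
have fE0 y : (0 <= (EFin \o f) y)%E by rewrite lee_fin.
have mY : @measurable_fun _ _ T (measurableTypeR R) setT Y.
  exact: (measurable_funPT Y).
pose Z : {RV P >-> measurableTypeR R} :=
  @mfun_Sub _ _ T (measurableTypeR R) Y (mem_set mY).
have -> : (\int[P]_o (f (Y o))%:E = \int[distribution P Z]_y (EFin \o f) y)%E.
  by rewrite ge0_integral_distribution.
rewrite (integral_density (@measurable_exponential_pdf R 1)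
  (fun y => exponential_pdf_ge0 ler01 y) (nu := distribution P Z) Y_exp)//.
rewrite integral_itv_obnd_cbnd; last first.
  apply/measurable_funTS/measurable_EFinP; apply: measurable_funM => //.
    exact: measurableT_comp.
  rewrite [RHS]integral_mkcond; apply: eq_integral => y _.
  rewrite patchE mem_setE in_itv/= andbT -EFinM /exponential_pdf patchE.
  rewrite mem_setE in_itv/= andbT; case: ifP => _.
    by rewrite mul1r mulN1r.
  by rewrite mulr0.
Qed.

Lemma exp_law_moment q : (\int[P]_o (Y o `^ q)%:E = exp_moment q)%E.
Proof.
rewrite (exp_law_integral (f := fun y => y `^ q))// => y.
exact: powR_ge0.
Qed.

Lemma exp_law_prob (B : set R) : measurable B ->
  P (Y @^-1` B) = (\int[mu]_(y in B `&` `]0%R, +oo[) (expR (- y))%:E)%E.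
Proof.
move=> mB.
have mYB : measurable (Y @^-1` B) by exact: measurable_funPTI.
rewrite -[in LHS](setIT (Y @^-1` B)) -integral_indic//.
have -> : (\int[P]_o (\1_(Y @^-1` B) o)%:E = \int[P]_o (\1_B (Y o) : R)%:E)%E.
  by apply: eq_integral => o _; rewrite !indicE; congr (_%:R%:E); apply/idP/idP; rewrite !inE.
rewrite (exp_law_integral (f := \1_B))//.
rewrite integral_mkcond [RHS]integral_mkcond; apply: eq_integral => y _.
rewrite !patchE in_setI indicE andbC.
by case: ifP => //= _; case: ifP => _; rewrite ?mul1r ?mul0r.
Qed.

Lemma exp_law_gt0 : {ae P, forall o, 0 < Y o}.
Proof.
exists (Y @^-1` `]-oo, 0%R]); split.
- exact: measurable_funPTI.
- rewrite exp_law_prob// (_ : _ `&` _ = set0) ?integral_set0//.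
  apply/seteqP; split => // y /=; rewrite !in_itv/= andbT => -[y0].
  by rewrite ltNge y0.
- by move=> o /=; rewrite in_itv/= leNgt => /negP.
Qed.

(** The absolute value is there because the frailty model is built on [|E i|]; almost surely it
    changes nothing. *)
Lemma exp_law_tail (s : R) : 0 <= s -> P (Y @^-1` [set y | s <= `|y|]) = (expR (- s))%:E.
Proof.
move=> s0.
have mB : measurable [set y : R | s <= `|y|].
  rewrite -[X in measurable X]setTI.
  have mf : measurable_fun setT (fun y : R => s <= `|y|).
    by apply: measurable_fun_ler => //; exact: measurable_normr.
  by have := mf measurableT [set true] I.
rewrite exp_law_prob// -integral_expRN.
have mexp (D : set R) : measurable_fun D (fun y : R => (expR (- y))%:E).
  by apply/measurable_funTS/measurable_EFinP/measurableT_comp.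
have [s1|s1] := ltP 0 s.
  rewrite integral_itv_obnd_cbnd//; congr (integral _ _ _).
  apply/seteqP; split => y /=; rewrite !in_itv/= !andbT.
    by move=> [+ y0]; rewrite gtr0_norm.
  by move=> sy; have y0 := lt_le_trans s1 sy; rewrite gtr0_norm.
have -> : s = 0 by apply/eqP; rewrite eq_le s0 s1.
congr (integral _ _ _); apply/seteqP; split => y /=; rewrite !in_itv/= !andbT.
  by case.
by move=> y0; split.
Qed.

End ExponentialLaw.

(** * The Marshall-Olkin representation of the Clayton copula *)

(* A copula prescribes the law on lower orthants only; these form a pi-system,
   whose sigma-algebra already makes every coordinate measurable. *)
Section LowerOrthants.
Context {R : realType} (m : nat).
Implicit Types x : 'I_m -> R.

Definition lower_orthant x : set ('I_m -> R) := [set v | forall i, v i <= x i].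
Definition lower_orthants : set (set ('I_m -> R)) := range lower_orthant.

Local Notation V := (g_sigma_algebraType lower_orthants).

Lemma lower_orthants_setI : setI_closed lower_orthants.
Proof.
move=> _ _ [x _ <-] [y _ <-]; exists (fun i => Num.min (x i) (y i)) => //.
apply/seteqP; split => v /=.
  by move=> h; split => i; have := h i; rewrite le_min => /andP[].
by move=> [hx hy] i; rewrite le_min hx hy.
Qed.

Lemma lower_orthants_cover :
  \bigcup_k lower_orthant (fun=> k%:R) = [set: 'I_m -> R].
Proof.
apply/seteqP; split => // v _.
(* A single [k] has to bound all coordinates; the sum of the individual bounds does so, even when
   [m = 0]. *)
exists (\sum_i (Num.truncn (v i)).+1)%N => // i.
rewrite (le_trans (ltW (truncnS_gt _)))// ler_nat (bigD1 i)//=.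
by rewrite leq_addr.
Qed.

Lemma measurable_lower_orthant x : measurable (lower_orthant x : set V).
Proof. by apply: sub_sigma_algebra; exists x. Qed.

(** A half-space [v i <= a] is the increasing union of the orthants bounded by [a] in direction [i]
    and by [k] in the others. *)
Lemma measurable_orthant_coord i : measurable_fun setT (fun v : V => v i).
Proof.
apply: (measurability _ (RGenOInfty.measurableE R)) => _ [_ [a ->] <-].
rewrite setTI -[X in measurable X]setCK; apply: measurableC.
rewrite (_ : ~` _ = \bigcup_k
    (lower_orthant (fun j => if j == i then a else k%:R) : set V)).
  by apply: bigcupT_measurable => k; exact: measurable_lower_orthant.
apply/seteqP; split => v /=; rewrite in_itv/= andbT.
  move=> /negP; rewrite -leNgt => via.
  have : (\bigcup_k lower_orthant (fun=> k%:R)) v by rewrite lower_orthants_cover.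
  move=> [k _ vk]; exists k => // j; case: eqP => [->//|_]; exact: vk.
by move=> [k _ /(_ i)]; rewrite eqxx => via; apply/negP; rewrite -leNgt.
Qed.

Lemma measurable_to_orthants d (Z : measurableType d) (Phi : Z -> V) :
  (forall i, measurable_fun setT (fun z => Phi z i)) -> measurable_fun setT Phi.
Proof.
move=> mPhi.
have H := @measurability _ _ Z V setT Phi lower_orthants.
apply: H => // _ [_ [x _ <-] <-].
rewrite setTI (_ : _ @^-1` _ =
    \bigcap_(i in [set: 'I_m]) ((fun z => Phi z i) @^-1` `]-oo, x i])).
  apply: fin_bigcap_measurable => // i _.
  by rewrite -[X in measurable X]setTI; apply: mPhi.
apply/seteqP; split => z /=; first by move=> h i _ /=; rewrite in_itv/= h.
by move=> h i; have /= := h i I; rewrite in_itv.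
Qed.

End LowerOrthants.

Section LawTransfer.
Context {R : realType} {m : nat}.
Local Notation V := (g_sigma_algebraType (@lower_orthants R m)).
Context d (Z : measurableType d) (mu : {measure set Z -> \bar R}).
Variables (dens : Z -> R) (Phi : Z -> V).
Hypotheses (mdens : measurable_fun setT dens) (dens_ge0 : forall z, 0 <= dens z).
Hypothesis mPhi : forall i, measurable_fun setT (fun z => Phi z i).
Context d' (O : measurableType d') (Q : probability O R).
Variable U : 'I_m -> {RV Q >-> R}.
Hypothesis U_law : forall x : 'I_m -> R,
  Q [set o | forall i, U i o <= x i] =
  (\int[mu]_(z in Phi @^-1` lower_orthant x) (dens z)%:E)%E.

Let nu (S : set V) := (\int[mu]_(z in Phi @^-1` S) (dens z)%:E)%E.

Let mdensE (D : set Z) : measurable_fun D (fun z => (dens z)%:E).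
Proof. by apply/measurable_funTS/measurable_EFinP. Qed.

Let mPhiS (S : set V) : measurable S -> measurable (Phi @^-1` S).
Proof. by move=> mS; rewrite -[X in measurable X]setTI; apply: measurable_to_orthants. Qed.

Let nu0 : nu set0 = 0%E.
Proof. by rewrite /nu preimage_set0 integral_set0. Qed.

Let nu_ge0 S : (0 <= nu S)%E.
Proof. by apply: integral_ge0 => z _; rewrite lee_fin. Qed.

Let nu_sigma_additive : semi_sigma_additive nu.
Proof.
move=> /= F mF tF mUF; rewrite /nu preimage_bigcup; apply: cvg_toP.
  apply: ereal_nondecreasing_is_cvgn => i j ij.
  by apply: lee_sum_nneg_natr => // k _ _; exact: nu_ge0.
rewrite ge0_integral_bigcup//=.
- by move=> k; exact: mPhiS.
- by move=> z _; rewrite lee_fin.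
- apply/trivIsetP => i j _ _ ij; rewrite -preimage_setI.
  by move/trivIsetP : tF => /(_ _ _ I I ij) ->; rewrite preimage_set0.
Qed.

HB.instance Definition _ := isMeasure.Build _ _ _
  nu nu0 nu_ge0 nu_sigma_additive.

Let Uvec (o : O) : V := fun i => U i o.

Let mUvec : measurable_fun setT Uvec.
Proof. by apply: measurable_to_orthants => i; exact: measurable_funPT. Qed.

(** The law of [U] and the image under [Phi] of [mu] weighted by [dens] agree on the pi-system of
    lower orthants, which covers the space; uniqueness of measures extends this to every measurable
    [S], in particular to the event that the weighted sum exceeds [t]. *)
Lemma law_transfer (S : set V) : measurable S ->
  Q [set o | S (fun i => U i o)] =
  (\int[mu]_(z in Phi @^-1` S) (dens z)%:E)%E.
Proof.
move=> mS.
transitivity (pushforward Q Uvec S); first by [].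
transitivity (nu S); last by [].
pose m1 : {measure set V -> \bar R} := pushforward Q Uvec.
pose m2 : {measure set V -> \bar R} := nu.
have H := @measure_unique _ R V (@lower_orthants R m)
  (fun k => lower_orthant (fun=> k%:R)) _ _ _ _ (m1 mUvec) m2.
apply: H => //.
- exact: lower_orthants_setI.
- by move=> k; exists (fun=> k%:R).
- exact: lower_orthants_cover.
- by move=> _ [x _ <-]; exact: U_law.
- move=> k; apply: (@le_lt_trans _ _ 1%E); last exact: ltry.
  by apply: probability_le1; rewrite -[X in measurable X]setTI; apply: mUvec => //; exact: measurable_lower_orthant.
Qed.

End LawTransfer.

Lemma measurable_invr (R : realType) : measurable_fun setT (fun x : R => x^-1).
Proof.
rewrite (_ : (fun x => _) = (fun x : R =>
    if 0 <= x then x `^ (-1) else - ((- x) `^ (-1)))).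
  apply: measurable_fun_ifT; first exact: measurable_fun_ler.
    exact: measurable_powR.
  apply: measurableT_comp => //; apply: (measurableT_comp (measurable_powR (-1))).
  exact: oppr_measurable.
apply/funext => x; case: ifPn => [x0|]; first by rewrite powR_inv1.
by rewrite -ltNge => x0; rewrite powR_inv1 ?invrN ?opprK// oppr_ge0 ltW.
Qed.

Lemma measurable_cot (R : realType) : measurable_fun setT (@cot R).
Proof.
apply: measurable_funM.
  by apply: continuous_measurable_fun; exact: continuous_cos.
apply: (measurableT_comp (@measurable_invr R)).
by apply: continuous_measurable_fun; exact: continuous_sin.
Qed.

Section FrailtyCoordinate.
Context {R : realType}.
Implicit Types theta x e v : R.

(* [U = (1 + e / V) ^ (- 1 / theta)] with [V = x ^ theta]: the Marshall-Olkin
   representation of the Clayton copula. *)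
Definition frailty_coord theta x e : R := x * (x `^ theta + e) `^ (- (1 / theta)).

Lemma frailty_coord_gt0 theta x e : 0 < x -> 0 <= e -> 0 < frailty_coord theta x e.
Proof. by move=> x0 e0; rewrite mulr_gt0// powR_gt0// ltr_wpDr// powR_gt0. Qed.

Lemma powRK theta x : 0 < theta -> 0 <= x -> (x `^ theta) `^ (1 / theta) = x.
Proof. by move=> t0 x0; rewrite -powRrM mul1r mulfV ?gt_eqF// powRr1. Qed.

Lemma powRVK theta x : 0 < theta -> 0 <= x -> (x `^ (1 / theta)) `^ theta = x.
Proof. by move=> t0 x0; rewrite -powRrM mul1r mulVf ?gt_eqF// powRr1. Qed.

Lemma ler_powR_theta theta x v : 0 < theta -> 0 <= x -> 0 <= v ->
  (x <= v `^ (1 / theta)) = (x `^ theta <= v).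
Proof.
move=> t0 x0 v0; apply/idP/idP => h.
  have := ge0_ler_powR (ltW t0); move=> /(_ _ _ _ _ h); rewrite powRVK//.
  by apply; rewrite nnegrE// powR_ge0.
have p0 : 0 <= 1 / theta by rewrite divr_ge0// ltW.
have := ge0_ler_powR p0; move=> /(_ _ _ _ _ h); rewrite powRK//.
by apply; rewrite nnegrE// powR_ge0.
Qed.

(** For a fixed frailty the event [U_i <= v] becomes an upper tail of the exponential, and the
    expression [v ^ (- theta) - 1] of the Clayton formula appears. *)
Lemma frailty_coord_le theta x e v : 0 < theta -> 0 < x -> 0 <= e -> 0 < v ->
  (frailty_coord theta x e <= v) = (x `^ theta * (v `^ (- theta) - 1) <= e).
Proof.
move=> t0 x0 e0 v0; rewrite /frailty_coord [in X in X <= v]powRN.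
have y0 : 0 < x `^ theta + e by rewrite ltr_wpDr// powR_gt0.
rewrite ler_pdivrMr ?powR_gt0// mulrC -ler_pdivrMr//.
have xv0 : 0 <= x / v by rewrite divr_ge0// ltW.
rewrite ler_powR_theta ?(ltW y0)// powRM ?invr_ge0 ?(ltW v0) ?(ltW x0)//.
by rewrite -powR_inv1 ?(ltW v0)// -powRrM mulN1r mulrBr mulr1 lerBlDl.
Qed.

Lemma frailty_coord_le1 theta x e : 0 < theta -> 0 < x -> 0 <= e ->
  frailty_coord theta x e <= 1.
Proof.
by move=> t0 x0 e0; rewrite frailty_coord_le// powR1 subrr mulr0.
Qed.

End FrailtyCoordinate.

Lemma uniform_cdf {R : realType} d (T : measurableType d) (P : probability T R)
    (U : {RV P >-> R}) (v : R) : has_law U (uniform_prob (@ltr01 R)) ->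
  fine (cdf U v) = if v <= 0 then 0 else Num.min v 1.
Proof.
move=> Ulaw; rewrite /cdf Ulaw// /uniform_prob integral_uniform_pdf.
rewrite (_ : _ `&` _ = `[0, Num.min v 1]%classic); last first.
  apply/seteqP; split => y /=; rewrite !in_itv/= le_min.
    by move=> [yv /andP[-> ->]]; rewrite yv.
  by move=> /and3P[-> -> ->].
rewrite (eq_integral (cst 1%E)); last first.
  move=> y; rewrite inE/= in_itv/= le_min /uniform_pdf => /and3P[-> _ ->].
  by rewrite subr0 invr1.
rewrite integral_cst//= mul1e lebesgue_measure_itv/= lte_fin lt_min ltr01 andbT.
by case: leP => //= _; rewrite oppr0 addr0.
Qed.

Section ClaytonRepresentation.
Context {R : realType} (m : nat) (theta : R) (w : 'I_m -> R).
Context dU (TU : measurableType dU) (PU : probability TU R).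
Variable U : 'I_m -> {RV PU >-> R}.
Context dE (TE : measurableType dE) (PE : probability TE R).
Variable E : 'I_m -> {RV PE >-> R}.
Hypotheses (theta_gt0 : 0 < theta).
Hypothesis U_unif : forall i, has_law (U i) (uniform_prob (@ltr01 R)).
Hypothesis U_clayton : has_copula U (@clayton R theta m).
Hypothesis E_iid : iid_exp1 E.
Local Notation mu := (@lebesgue_measure R).
Local Notation a := (coef_a theta).
Local Notation p := (1 / theta).

Let p_gt0 : 0 < p. Proof. by rewrite divr_gt0. Qed.

Lemma coef_a_gt0 : 0 < a.
Proof. by rewrite invr_gt0 Gamma_gt0. Qed.

(* The law of [V ^ (1 / theta)] for [V] of law Gamma with shape [1 / theta]. *)
Definition frailty_density (x : R) : R :=
  if 0 < x then a * expR (- (x `^ theta)) else 0.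

Let dens (z : TE * measurableTypeR R) : R := frailty_density z.2.
Let Phi (z : TE * measurableTypeR R) : 'I_m -> R :=
  fun i => frailty_coord theta z.2 `|E i z.1|.

Lemma frailty_density_ge0 x : 0 <= frailty_density x.
Proof.
by rewrite /frailty_density; case: ifP => // _; rewrite mulr_ge0 ?expR_ge0// ltW ?coef_a_gt0.
Qed.

Lemma measurable_frailty_density : measurable_fun setT frailty_density.
Proof.
apply: measurable_fun_ifT => //; first exact: measurable_fun_ltr.
apply: measurable_funM => //; apply: measurableT_comp => //.
apply: measurableT_comp => //; exact: measurable_powR.
Qed.

Lemma measurable_frailty_coord i : measurable_fun setT (fun z => Phi z i).
Proof.
apply: measurable_funM; first exact: measurable_snd.
apply: (measurableT_comp (measurable_powR _)); apply: measurable_funD.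
  by apply: (measurableT_comp (measurable_powR _)); exact: measurable_snd.
apply: measurableT_comp => //; apply: measurableT_comp => //.
Qed.

Lemma iid_exp1_tails (s : 'I_m -> R) : (forall i, 0 <= s i) ->
  PE [set o | forall i, s i <= `|E i o|] = (expR (- \sum_i s i))%:E.
Proof.
move=> s0; have [E_ind E_exp] := E_iid.
have mB i : measurable [set y : R | s i <= `|y|].
  rewrite -[X in measurable X]setTI.
  have mf : measurable_fun setT (fun y : R => s i <= `|y|).
    by apply: measurable_fun_ler => //; exact: measurable_normr.
  by have := mf measurableT [set true] I.
have := E_ind [set: 'I_m]%SET (fun i => [set y | s i <= `|y|]) mB.
rewrite (_ : [set o | _] = [set o | forall i, s i <= `|E i o|]); last first.
  by apply/seteqP; split => o /= h i; [apply: h; rewrite inE|move=> _; apply: h].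
move=> ->.
transitivity (\prod_(i in [set: 'I_m]%SET) (expR (- s i))%:E)%E.
  by apply: eq_bigr => i _; rewrite exp_law_tail.
under eq_bigl do rewrite inE.
rewrite -sumrN.
by elim/big_rec2 : _ => [|i y x _ ->]; rewrite ?expR0// expRD EFinM.
Qed.

(** Given the frailty the coordinates are independent, so the exponential tails multiply. The
    coordinates never exceed 1, whence the truncation of [v i], and are positive, whence the value 0
    as soon as some [v i <= 0], as in [clayton]. *)
Lemma frailty_mass_orthant (x : R) (v : 'I_m -> R) : 0 < x ->
  PE [set o | forall i, frailty_coord theta x `|E i o| <= v i] =
  if [forall i, 0 < v i]
  then (expR (- (x `^ theta * \sum_i ((Num.min (v i) 1) `^ (- theta) - 1))))%:E
  else 0%E.
Proof.
move=> x0; case: ifPn => [/forallP v0|]; last first.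
  rewrite negb_forall => /existsP[i]; rewrite -leNgt => vi0.
  rewrite (_ : [set o | _] = set0) ?measure0//.
  apply/seteqP; split => // o /= /(_ i) /le_trans /(_ vi0).
  by rewrite leNgt frailty_coord_gt0.
have min0 i : 0 < Num.min (v i) 1 by rewrite lt_min v0 ltr01.
rewrite mulr_sumr -iid_exp1_tails.
  congr (PE _); apply/seteqP; split => o /= h i; have := h i.
    move=> hv; rewrite -frailty_coord_le// le_min hv/=.
    by rewrite frailty_coord_le1.
  by rewrite -frailty_coord_le// le_min => /andP[].
move=> i; rewrite mulr_ge0 ?powR_ge0// subr_ge0 powRN invf_ge1 ?powR_gt0//.
apply: (@le_trans _ _ (1 `^ theta)); last by rewrite powR1.
apply: ge0_ler_powR; rewrite ?nnegrE ?(ltW theta_gt0) ?(ltW (min0 i))//.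
by rewrite ge_min lexx orbT.
Qed.

(** Integrating the conditional mass against the frailty density gives [a] times the integral of
    [exp (- lambda x ^ theta)], where [lambda] is the base in the Clayton formula; [a] cancels the
    Gamma factor of [stretched_exp_integral]. *)
Lemma clayton_frailty_law (v : 'I_m -> R) :
  PU [set o | forall i, U i o <= v i] =
  (\int[PE \x mu]_(z in Phi @^-1` lower_orthant v) (dens z)%:E)%E.
Proof.
have mPhi := measurable_frailty_coord.
have mS : measurable (Phi @^-1` lower_orthant v).
  rewrite -[X in measurable X]setTI.
  by apply: (measurable_to_orthants (Phi := Phi)) => //; exact: measurable_lower_orthant.
have mdens : measurable_fun setT dens.
  by apply: measurableT_comp; [exact: measurable_frailty_density|exact: measurable_snd].
have mdensE : measurable_fun setT (EFin \o dens) by exact/measurable_EFinP.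
have mr : measurable_fun (Phi @^-1` lower_orthant v) (EFin \o dens).
  exact: measurable_funTS.
rewrite U_clayton integral_mkcond fubini_tonelli2//=; last 2 first.
- exact: (measurable_restrictT _ mS).1 mr.
- by move=> z; apply: erestrict_ge0 => y _; rewrite lee_fin frailty_density_ge0.
transitivity (\int[mu]_(x in `]0%R, +oo[) ((a * expR (- (x `^ theta)))%:E *
   PE [set o | (forall i, frailty_coord theta x `|E i o| <= v i)%R]))%E; last first.
  rewrite integral_mkcond; apply: eq_integral => x _; rewrite patchE.
  rewrite mem_setE in_itv/= andbT; case: ifPn => [x0|nx0]; last first.
    rewrite [RHS]integral0_eq// => o _; rewrite patchE; case: ifP => // _.
    by rewrite /dens /frailty_density (negbTE nx0).
  set S := [set o | _].
  have mSx : measurable S.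
    rewrite (_ : S = (fun o => (o, x)) @^-1` (Phi @^-1` lower_orthant v)) //.
    by rewrite -[X in measurable X]setTI; apply: measurable_pair2.
  rewrite -[in LHS](setIT S) -integral_indic// -ge0_integralZl//.
  - apply: eq_integral => o _; rewrite patchE indicE.
    rewrite (_ : ((o, x) \in Phi @^-1` lower_orthant v) = (o \in S)).
      by case: ifP => _; rewrite ?mule1 ?mule0// /dens /frailty_density x0.
    by apply/idP/idP; rewrite !inE.
  - by apply/measurable_EFinP; exact: measurable_indic.
  - by rewrite lee_fin mulr_ge0 ?expR_ge0// ltW ?coef_a_gt0.
rewrite /clayton.
have cdfE i : fine (cdf (U i) (v i)) = if v i <= 0 then 0 else Num.min (v i) 1.
  exact: uniform_cdf.
have forallE : [forall i, 0 < fine (cdf (U i) (v i))] = [forall i, 0 < v i].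
  apply: eq_forallb => i; rewrite cdfE; have [vi|vi] := leP (v i) 0.
    by rewrite ltxx.
  by rewrite lt_min vi ltr01.
rewrite forallE; case: ifPn => [v0|nv0]; last first.
  rewrite integral0_eq// => x; rewrite /= in_itv/= andbT => x0.
  by rewrite frailty_mass_orthant// (negbTE nv0) mule0.
have := v0 => /forallP v0'.
set lambda := _ - _ + 1.
(* The summand 1 comes from the exponent of the frailty density itself, the others from the
   conditional tails. *)
have lambdaE : lambda = 1 + \sum_i (Num.min (v i) 1 `^ (- theta) - 1).
  rewrite big_split/= sumr_const card_ord mulNrn /lambda [LHS]addrC; congr (_ + (_ - _)).
  by apply: eq_bigr => i _; rewrite cdfE leNgt v0'.
have lambda1 : 1 <= lambda.
  rewrite lambdaE lerDl; apply: sumr_ge0 => i _.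
  have min0 : 0 < Num.min (v i) 1 by rewrite lt_min v0' ltr01.
  rewrite subr_ge0 powRN invf_ge1 ?powR_gt0//.
  apply: (@le_trans _ _ (1 `^ theta)); last by rewrite powR1.
  apply: ge0_ler_powR; rewrite ?nnegrE ?(ltW theta_gt0) ?(ltW min0)//.
  by rewrite ge_min lexx orbT.
have lambda0 : 0 < lambda by rewrite (lt_le_trans ltr01).
transitivity (a%:E * \int[mu]_(x in `]0%R, +oo[) (expR (- (lambda * x `^ theta)))%:E)%E.
  rewrite stretched_exp_integral// -EFinM mulrCA /coef_a mulVf ?mulr1//.
  by rewrite gt_eqF// Gamma_gt0.
rewrite -ge0_integralZl//; last 2 first.
- apply/measurable_funTS/measurable_EFinP; apply: measurableT_comp => //.
  apply: measurableT_comp => //; apply: measurable_funM => //.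
- by rewrite lee_fin ltW ?coef_a_gt0.
apply: eq_integral => x; rewrite inE/= in_itv/= andbT => x0.
rewrite frailty_mass_orthant// v0 -!EFinM -mulrA -expRD; congr (_ * expR _)%:E.
by rewrite lambdaE mulrDl mul1r opprD [x `^ theta * _]mulrC.
Qed.

Definition frailty_tail_set (t : R) (e : 'I_m -> R) : set R :=
  [set x | 0 < x /\ t < \sum_i w i * cot (pi * frailty_coord theta x (e i) / 2)].

(* The probability, conditionally on [E = e], that the weighted sum exceeds [t]. *)
Definition frailty_tail (t : R) (e : 'I_m -> R) : \bar R :=
  (\int[mu]_(x in frailty_tail_set t e) (a * expR (- (x `^ theta)))%:E)%E.

Let tail_event (t : R) : set (g_sigma_algebraType (@lower_orthants R m)) :=
  [set v | t < \sum_i w i * cot (pi * v i / 2)].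

Let measurable_tail_event t : measurable (tail_event t).
Proof.
rewrite -[X in measurable X]setTI.
have mf : measurable_fun setT
    (fun v : g_sigma_algebraType (@lower_orthants R m) =>
       t < \sum_i w i * cot (pi * v i / 2)).
  apply: measurable_fun_ltr => //; apply: measurable_sum => i.
  apply: measurable_funM => //; apply: (measurableT_comp (@measurable_cot R)).
  by apply: measurable_funM => //; apply: measurable_funM => //; exact: measurable_orthant_coord.
by have := mf measurableT [set true] I.
Qed.

Let tail_density t (z : TE * measurableTypeR R) : \bar R :=
  ((fun z => (dens z)%:E) \_ (Phi @^-1` tail_event t)) z.

Let tail_density_ge0 t z : (0 <= tail_density t z)%E.
Proof. by apply: erestrict_ge0 => y _; rewrite lee_fin frailty_density_ge0. Qed.

Let measurable_tail_density t : measurable_fun setT (tail_density t).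
Proof.
have mS : measurable (Phi @^-1` tail_event t).
  rewrite -[X in measurable X]setTI.
  by apply: (measurable_to_orthants (Phi := Phi)) => //; exact: measurable_frailty_coord.
have mdens : measurable_fun setT dens.
  by apply: measurableT_comp; [exact: measurable_frailty_density|exact: measurable_snd].
have mdensE : measurable_fun setT (EFin \o dens) by exact/measurable_EFinP.
have mr : measurable_fun (Phi @^-1` tail_event t) (EFin \o dens).
  exact: measurable_funTS.
exact: (measurable_restrictT _ mS).1 mr.
Qed.

Let tail_densityE t o :
  fubini_F mu (tail_density t) o = frailty_tail t (fun i => `|E i o|).
Proof.
rewrite /fubini_F /frailty_tail [RHS]integral_mkcond; apply: eq_integral => x _.
rewrite /tail_density !patchE /dens /frailty_density /=.
have [x0|x0] := ltP 0 x.
  rewrite (_ : (_ \in _) = (x \in frailty_tail_set t (fun i => `|E i o|))) //.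
  by apply/idP/idP; rewrite !inE => h; [split|case: h].
rewrite if_same; case: ifPn => //; rewrite inE => -[].
by rewrite ltNge x0.
Qed.

Lemma measurable_frailty_tail t :
  measurable_fun setT (fun o => frailty_tail t (fun i => `|E i o|)).
Proof.
have := measurable_fun_fubini_tonelli_F (m2 := mu) (tail_density t)
  (measurable_tail_density t) (tail_density_ge0 t).
by apply: eq_measurable_fun => o _; exact: tail_densityE.
Qed.

(** [law_transfer] turns the probability into an integral over outcome and frailty, and Tonelli's
    theorem integrates the frailty out. *)
Lemma sum_tail_frailty t :
  (sum_tail w U t)%:E = (\int[PE]_o frailty_tail t (fun i => `|E i o|%R))%E.
Proof.
rewrite /sum_tail.
have mdens : measurable_fun setT dens.
  by apply: measurableT_comp; [exact: measurable_frailty_density|exact: measurable_snd].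
have H := law_transfer (mu := (PE \x mu)%E) mdens (fun z => frailty_density_ge0 z.2)
  measurable_frailty_coord clayton_frailty_law (measurable_tail_event t).
have mT : measurable [set o | t < \sum_i w i * cot (pi * U i o / 2)].
  rewrite -[X in measurable X]setTI.
  have mf : measurable_fun setT (fun o => t < \sum_i w i * cot (pi * U i o / 2)).
    apply: measurable_fun_ltr => //; apply: measurable_sum => i.
    apply: measurable_funM => //; apply: (measurableT_comp (@measurable_cot R)).
    by apply: measurable_funM => //; apply: measurable_funM.
  by have := mf measurableT [set true] I.
rewrite fineK ?fin_num_measure// [LHS]H integral_mkcond.
rewrite (fubini_tonelli1 (tail_density t))//.
by apply: eq_integral => o _; rewrite tail_densityE.
Qed.

End ClaytonRepresentation.

(** * The tail conditionally on the exponentials *)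

Section RealLemmas.
Context {R : realType}.
Implicit Types x y e r p q : R.

Lemma cvg_at_right_of_pos T (F : set_system T) (FF : Filter F) (f : T -> R) :
  f x @[x --> F] --> (0 : R) -> (\forall x \near F, 0 < f x) -> f x @[x --> F] --> 0^'+.
Proof.
move=> f0 fpos P; rewrite /at_right /within/= => nP.
have := f0 _ nP; apply: (filterS2 _ _ fpos) => x /=.
by move=> fx0; apply.
Qed.

Lemma cvg_dnbhs_of_pos T (F : set_system T) (FF : Filter F) (f : T -> R) :
  f x @[x --> F] --> (0 : R) -> (\forall x \near F, 0 < f x) -> f x @[x --> F] --> 0^'.
Proof.
move=> f0 fpos P; rewrite /dnbhs /within/= => nP.
have := f0 _ nP; apply: (filterS2 _ _ fpos) => x /=.
by move=> fx0; apply; rewrite gt_eqF.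
Qed.

Lemma continuous_powR_pos q x : 0 < x -> {for x, continuous (fun y => y `^ q)}.
Proof.
move=> x0; apply/differentiable_continuous/derivable1_diffP.
by case: (@is_derive1_powR R q x x0).
Qed.

Lemma powR_slope_cvg p e : 0 < e ->
  ((r + e) `^ p - e `^ p) / r @[r --> 0^'] --> p * e `^ (p - 1).
Proof.
move=> e0; have [df <-] := @is_derive1_powR R p e e0.
have -> : (fun r => ((r + e) `^ p - e `^ p) / r) =
    (fun h => h^-1 *: (((fun y => y `^ p) \o shift e) (h *: 1) - e `^ p)).
  by apply/funext => h; rewrite /GRing.scale/= mulr1 mulrC.
exact: df.
Qed.

Lemma powR_diff p e r : 0 < e -> 0 < r ->
  exists2 xi, e < xi < r + e & (r + e) `^ p - e `^ p = p * xi `^ (p - 1) * r.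
Proof.
move=> e0 r0; have er : e < r + e by rewrite ltrDr.
have [||xi] := @MVT R (fun y => y `^ p) (fun y => p * y `^ (p - 1)) e (r + e) er.
- by move=> y; rewrite in_itv/= => /andP[ey _]; apply: is_derive1_powR; exact: lt_trans ey.
- apply: derivable_within_continuous => y; rewrite in_itv/= => /andP[ey _].
  by case: (@is_derive1_powR R p y (lt_le_trans e0 ey)).
- by rewrite in_itv/= addrK => ? ->; exists xi.
Qed.

Lemma ler_powRN q x y : q <= 0 -> 0 < x -> x <= y -> y `^ q <= x `^ q.
Proof.
move=> q0 x0 xy; have y0 := lt_le_trans x0 xy.
rewrite -[q]opprK !(powRN _ (- q)) lef_pV2 ?posrE ?powR_gt0//.
by apply: ge0_ler_powR; rewrite ?oppr_ge0 ?nnegrE// ltW.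
Qed.

(** [z ^ q] is monotone in [z], in a direction that depends on the sign of [q]; the sum of the two
    end values covers both. The exponent of interest, [1 / theta - 1], takes either sign. *)
Lemma powR_between q x y z : 0 < x -> x <= z -> z <= y -> z `^ q <= x `^ q + y `^ q.
Proof.
move=> x0 xz zy; have z0 := lt_le_trans x0 xz.
have [q0|/ltW q0] := leP q 0.
  by apply: ler_wpDr; rewrite ?powR_ge0// ler_powRN.
apply: ler_wpDl; rewrite ?powR_ge0//.
by apply: ge0_ler_powR; rewrite ?nnegrE// ltW// (lt_le_trans z0).
Qed.

Lemma powRD_le p x y : 0 <= p -> 0 <= x -> 0 <= y ->
  (x + y) `^ p <= 2 `^ p * (x `^ p + y `^ p).
Proof.
move=> p0; wlog xy : x y / x <= y.
  move=> H x0 y0; have [xy|/ltW yx] := leP x y; first exact: H.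
  by rewrite addrC [X in _ * X]addrC; exact: H.
move=> x0 y0; apply: (@le_trans _ _ ((2 * y) `^ p)).
  by apply: ge0_ler_powR; rewrite ?nnegrE ?addr_ge0 ?mulr_ge0//; lra.
by rewrite powRM// ler_wpM2l ?powR_ge0// lerDr powR_ge0.
Qed.

(** For [p <= 1] the power is nonincreasing, so [r] drops out; for [p > 1] it is split by
    [powRD_le], and [r] gives way to a bound [rho] that will not depend on [t]. The factor
    [2 ^ p >= 1] suits both cases. *)
Lemma powR_shift_le p e r rho : 0 < p -> 0 < e -> 0 < r -> r <= rho ->
  (r + e) `^ (p - 1) <= 2 `^ p * (rho `^ (p - 1) + e `^ (p - 1)).
Proof.
move=> p0 e0 r0 rrho.
have two_ge1 q : 0 <= q -> 1 <= 2 `^ q :> R.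
  by move=> q0; rewrite -[leLHS](powRr0 2) ler_powR// ler1n.
have [p1|p1] := leP p 1.
  apply: (@le_trans _ _ (e `^ (p - 1))).
    by rewrite ler_powRN ?lerDr ?(ltW r0)// subr_le0.
  apply: (@le_trans _ _ (rho `^ (p - 1) + e `^ (p - 1))).
    by rewrite lerDr powR_ge0.
  by rewrite ler_peMl ?two_ge1 ?addr_ge0 ?powR_ge0// ltW.
have p10 : 0 <= p - 1 by rewrite subr_ge0 ltW.
apply: (le_trans (powRD_le p10 (ltW r0) (ltW e0))).
apply: ler_pM; rewrite ?powR_ge0 ?addr_ge0 ?powR_ge0//.
  by rewrite ler_powR ?ler1n// gerBl.
rewrite lerD2r; apply: ge0_ler_powR; rewrite ?nnegrE ?(ltW r0)//.
exact: le_trans (ltW r0) rrho.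
Qed.

End RealLemmas.

Section FrailtyIntegral.
Context {R : realType} (theta : R).
Hypothesis theta_gt0 : 0 < theta.
Local Notation mu := (@lebesgue_measure R).

(** [D] is the integral of [1 - exp (- s ^ theta)], enclosed by [y exp (- y) <= 1 - exp (- y) <= y]
    at [y = s ^ theta]; [coef_b * x ^ (theta + 1)] is the integral of [s ^ theta]. As [x] tends to 0
    the two bounds become equivalent, so the enclosure provides the domination as well as the
    limit. *)
Lemma stretched_exp_defect (x : R) : 0 < x ->
  exists2 D : R,
    expR (- (x `^ theta)) * (coef_b theta * x `^ (theta + 1)) <= D <=
      coef_b theta * x `^ (theta + 1) &
    (\int[mu]_(s in `]0%R, x[) (expR (- (s `^ theta)))%:E = (x - D)%:E)%E.
Proof.
move=> x0.
have mexp (S : set R) : measurable_fun S (fun s : R => expR (- (s `^ theta))).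
  apply: measurable_funTS; apply: measurableT_comp => //.
  by apply: measurableT_comp => //; exact: measurable_powR.
have mexpE (S : set R) : measurable_fun S (fun s : R => (expR (- (s `^ theta)))%:E).
  exact/measurable_EFinP.
have mdefE (S : set R) : measurable_fun S (fun s : R => (1 - expR (- (s `^ theta)))%:E).
  by apply/measurable_EFinP; apply: measurable_funB.
have mpow (S : set R) : measurable_fun S (fun s : R => (s `^ theta)%:E).
  by apply/measurable_funTS/measurable_EFinP; exact: measurable_powR.
have def0 s : 0 <= 1 - expR (- (s `^ theta)).
  by rewrite subr_ge0 -expR0 ler_expR oppr_le0 powR_ge0.
set I1 := (\int[mu]_(s in _) _)%E.
pose I2 := (\int[mu]_(s in `]0%R, x[) (1 - expR (- (s `^ theta)))%:E)%E.
have powE : (\int[mu]_(s in `]0%R, x[) (s `^ theta)%:E =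
    (coef_b theta * x `^ (theta + 1))%:E)%E.
  rewrite integral_powR0//; last by rewrite (lt_trans _ theta_gt0)// ltrN10.
  by rewrite /coef_b mulrC addrC.
have I12 : (I1 + I2 = x%:E)%E.
  rewrite /I1 /I2 -ge0_integralD//=.
  - rewrite (eq_integral (cst 1%E)); last first.
      by move=> s _; rewrite -EFinD addrC subrK.
    by rewrite integral_cst//= lebesgue_measure_itv/= lte_fin x0 mul1e sube0.
  - exact: mexpE.
  - by move=> s _; rewrite lee_fin.
  - exact: mdefE.
have I1_ge0 : (0 <= I1)%E by apply: integral_ge0 => s _; rewrite lee_fin expR_ge0.
have I2_ge0 : (0 <= I2)%E by apply: integral_ge0 => s _; rewrite lee_fin.
have I2_le : (I2 <= (coef_b theta * x `^ (theta + 1))%:E)%E.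
  rewrite -powE; apply: ge0_le_integral => //=.
  - by move=> s _; rewrite lee_fin.
  - exact: mdefE.
  - exact: mpow.
  move=> s _; rewrite lee_fin lerBlDl.
  by have := expR_ge1Dx (- (s `^ theta)); lra.
have I2_ge : ((expR (- (x `^ theta)) * (coef_b theta * x `^ (theta + 1)))%:E <= I2)%E.
  rewrite EFinM -powE -ge0_integralZl//; last 2 first.
  - exact: mpow.
  - by move=> s _; rewrite lee_fin powR_ge0.
  apply: ge0_le_integral => //=.
  - by move=> s _; rewrite mule_ge0// lee_fin ?expR_ge0 ?powR_ge0.
  - by apply: measurable_funeM; exact: mpow.
  - exact: mdefE.
  - move=> s; rewrite /= in_itv/= => /andP[s0 sx]; rewrite -EFinM lee_fin.
    apply: (@le_trans _ _ (expR (- (s `^ theta)) * s `^ theta)).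
      rewrite ler_wpM2r ?powR_ge0// ler_expR lerN2.
      by apply: ge0_ler_powR; rewrite ?nnegrE ltW.
    have := expR_ge1Dx (s `^ theta); have := expR_gt0 (- (s `^ theta)) => ge0 ge1.
    have -> : 1 - expR (- s `^ theta) = expR (- s `^ theta) * (expR (s `^ theta) - 1).
      by rewrite mulrBr -expRD addNr expR0 mulr1.
    by rewrite ler_wpM2l ?(ltW ge0)//; lra.
have I2_fin : I2 \is a fin_num by rewrite ge0_fin_numE// (le_lt_trans I2_le)// ltry.
exists (fine I2).
  by rewrite -!lee_fin fineK// I2_ge I2_le.
by rewrite EFinB fineK// -I12 addeK.
Qed.

End FrailtyIntegral.

Lemma cvg_sum_ord (R : realType) (m : nat) T (F : set_system T) (FF : Filter F)
    (f : 'I_m -> T -> R) (l : 'I_m -> R) :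
  (forall i, f i x @[x --> F] --> l i) ->
  \sum_i f i x @[x --> F] --> \sum_i l i.
Proof. by move=> fl; apply: cvg_big => //; exact: add_continuous. Qed.

Section SimplexSums.
Context {R : realType} {m : nat}.
Implicit Types w f g : 'I_m -> R.

Lemma simplex_sum_le w f g : simplex w -> (forall i, f i <= g i) ->
  \sum_i w i * f i <= \sum_i w i * g i.
Proof. by move=> [w0 _] fg; apply: ler_sum => i _; rewrite ler_wpM2l. Qed.

Lemma simplex_sum_ge0 w f : simplex w -> (forall i, 0 <= f i) ->
  0 <= \sum_i w i * f i.
Proof. by move=> [w0 _] f0; apply: sumr_ge0 => i _; rewrite mulr_ge0. Qed.

Lemma simplex_sum_cst w (k : R) : simplex w -> \sum_i w i * k = k.
Proof. by move=> [_ w1]; rewrite -mulr_suml w1 mul1r. Qed.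

Lemma simplex_support w : simplex w -> exists i, 0 < w i.
Proof.
move=> [w0 w1]; apply: contrapT => /forallNP h.
have : \sum_i w i = 0.
  apply: big1 => i _; apply/eqP; rewrite eq_le w0 andbT leNgt; exact/negP/h.
by rewrite w1 => /eqP; rewrite oner_eq0.
Qed.

Lemma simplex_sum_lt w f g : simplex w -> (forall i, f i < g i) ->
  \sum_i w i * f i < \sum_i w i * g i.
Proof.
move=> sw fg; have [i wi] := simplex_support sw; have [w0 _] := sw.
rewrite (bigD1 i)//= [ltRHS](bigD1 i)//=; apply: ltr_leD; first by rewrite ltr_pM2l.
by apply: ler_sum => j _; rewrite ler_wpM2l// ltW.
Qed.

Lemma simplex_sum_gt0 w f : simplex w -> (forall i, 0 < f i) ->
  0 < \sum_i w i * f i.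
Proof.
move=> sw f0; have := @simplex_sum_lt w (fun=> 0) f sw f0.
by rewrite simplex_sum_cst.
Qed.

End SimplexSums.

(** * The frailty level at which the weighted sum equals [t] *)

Section Threshold.
Context {R : realType} {m : nat} (theta : R) (w e : 'I_m -> R).
Hypotheses (theta_gt0 : 0 < theta) (w_simplex : simplex w).
Hypothesis e_gt0 : forall i, 0 < e i.
Local Notation p := (1 / theta).
Local Notation u x i := (frailty_coord theta x (e i)).
Local Notation c := (coef_c : R).
Local Notation K := (c * 2 `^ p).

Let p_gt0 : 0 < p. Proof. by rewrite divr_gt0. Qed.
Let c_gt0 : 0 < c. Proof. by rewrite divr_gt0 ?pi_gt0. Qed.
Let e_ge0 i : 0 <= e i. Proof. exact: ltW. Qed.

Definition power_mean : R := \sum_i w i * e i `^ p.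
Definition frailty_quantile (x : R) : R := \sum_i w i * cot (pi * u x i / 2).
Local Notation A := power_mean.
Local Notation Psi := frailty_quantile.

Lemma power_mean_gt0 : 0 < A.
Proof. by apply: simplex_sum_gt0 => // i; rewrite powR_gt0. Qed.

Lemma half_angle_coord x i : 0 < x -> 0 < pi * u x i / 2 < pi.
Proof.
move=> x0; have := half_angle (u := u x i).
rewrite frailty_coord_gt0// frailty_coord_le1//= => /(_ isT) [/andP[-> _] ->].
by [].
Qed.

Lemma frailty_coord_incr x y i : 0 < x -> x < y -> u x i < u y i.
Proof.
move=> x0 xy; have y0 := lt_trans x0 xy.
have ux0 : 0 < u x i by exact: frailty_coord_gt0.
rewrite ltNge frailty_coord_le// -ltNge.
have xt0 : 0 < x `^ theta by rewrite powR_gt0.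
have -> : u x i `^ (- theta) - 1 = e i / x `^ theta.
  rewrite /frailty_coord powRM ?powR_ge0 ?(ltW x0)// -powRrM mulrNN mul1r mulVf ?gt_eqF//.
  rewrite powRr1 ?addr_ge0 ?powR_ge0// powRN.
  by rewrite mulrDr mulVf ?gt_eqF// addrAC subrr add0r mulrC.
rewrite mulrCA ltr_pMr// ltr_pdivlMr// mul1r.
by apply: gt0_ltr_powR; rewrite ?nnegrE// ltW.
Qed.

Lemma frailty_quantile_decr x y : 0 < x -> x < y -> Psi y < Psi x.
Proof.
move=> x0 xy; have y0 := lt_trans x0 xy; apply: simplex_sum_lt => // i.
have /andP[ax0 axpi] := half_angle_coord i x0.
have /andP[ay0 aypi] := half_angle_coord i y0.
apply: (cot_decr ax0 _ aypi).
rewrite ltr_pM2r ?invr_gt0 ?ltr0n//.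
by rewrite (ltr_pM2l (pi_gt0 R)); exact: frailty_coord_incr.
Qed.

Lemma frailty_quantile_continuous x : 0 < x -> {for x, continuous Psi}.
Proof.
move=> x0; apply: cvg_sum_ord => i; apply: cvgM; first exact: cvg_cst.
have cang : {for x, continuous (fun y => pi * u y i / 2)}.
  apply: cvgM; last exact: cvg_cst.
  apply: cvgM; first exact: cvg_cst.
  apply: cvgM; first exact: cvg_id.
  apply: (@continuous_comp _ _ _ (fun y => y `^ theta + e i) (fun y => y `^ (- p))).
    by apply: cvgD; [exact: continuous_powR_pos|exact: cvg_cst].
  by apply: continuous_powR_pos; rewrite ltr_pwDl// powR_gt0.
apply: (@continuous_comp _ _ _ (fun y => pi * u y i / 2) cot) => //.
exact/continuous_cot/half_angle_coord.
Qed.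

(** With [1 / u = (x ^ theta + e_i) ^ (1 / theta) / x], multiplication by [x] clears the pole of the
    cotangent. At [Psi x = t] this becomes an implicit equation for [t * x], on which the expansion
    rests. *)
Lemma frailty_quantileE x : 0 < x ->
  x * Psi x = c * \sum_i w i * (x `^ theta + e i) `^ p
              - x * \sum_i w i * cot_defect (u x i).
Proof.
move=> x0; rewrite /frailty_quantile !mulr_sumr -sumrB; apply: eq_bigr => i _.
have y0 : 0 < x `^ theta + e i by rewrite ltr_pwDl// powR_gt0.
have -> : cot (pi * u x i / 2) = c / u x i - cot_defect (u x i).
  by rewrite /cot_defect opprB addrCA subrr addr0.
rewrite {1}/frailty_coord powRN invfM invrK.
have xn0 : x != 0 by rewrite gt_eqF.
by field.
Qed.

Lemma cot_defect_coord x i : 0 < x -> 0 <= cot_defect (u x i) <= 4 * u x i.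
Proof.
by move=> x0; apply: cot_defect_bounds; rewrite frailty_coord_gt0// frailty_coord_le1.
Qed.

Lemma frailty_threshold t : 2 * K <= t ->
  exists x, [/\ 0 < x, x <= 2 * K * A / t, Psi x = t &
    frailty_tail_set theta w t e = `]0, x[%classic].
Proof.
have K0 : 0 < K by rewrite mulr_gt0// powR_gt0.
move=> Kt; have t0 : 0 < t by rewrite (lt_le_trans _ Kt)// mulr_gt0.
have A0 := power_mean_gt0.
(* [x0] comes from dropping [x ^ theta] and bounding the defect by 4: [Psi x0 >= c A / x0 - 4 = t].
   [x1] comes from dropping the defect and from [(x ^ theta + e) ^ p <= 2 ^ p (x + e ^ p)]: then
   [x1 Psi x1 <= K x1 + K A], and each summand is at most [x1 t / 2] once [t >= 2 K]. *)
pose x0 := c * A / (t + 4); pose x1 := 2 * K * A / t.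
have t40 : 0 < t + 4 by rewrite addr_gt0.
have x00 : 0 < x0 by rewrite divr_gt0// mulr_gt0.
have x10 : 0 < x1 by rewrite divr_gt0// mulr_gt0// mulr_gt0.
have h0 : t <= Psi x0.
  rewrite -(ler_pM2l x00) frailty_quantileE//.
  have -> : x0 * t = c * A - x0 * 4.
    by rewrite /x0; field; rewrite gt_eqF.
  apply: lerB.
    rewrite ler_wpM2l ?(ltW c_gt0)//; apply: simplex_sum_le => // i.
    apply: ge0_ler_powR; rewrite ?nnegrE ?(ltW p_gt0) ?addr_ge0 ?powR_ge0//.
    by rewrite lerDr powR_ge0.
  rewrite ler_wpM2l ?(ltW x00)// -[leRHS](simplex_sum_cst 4 w_simplex).
  apply: simplex_sum_le => // i; have /andP[_ /le_trans] := cot_defect_coord i x00.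
  by apply; rewrite ler_piMr// frailty_coord_le1.
have h1 : Psi x1 <= t.
  rewrite -(ler_pM2l x10) frailty_quantileE//.
  apply: (@le_trans _ _ (c * \sum_i w i * (x1 `^ theta + e i) `^ p)).
    rewrite gerBl mulr_ge0 ?(ltW x10)//; apply: simplex_sum_ge0 => // i.
    by have /andP[] := cot_defect_coord i x10.
  apply: (@le_trans _ _ (K * x1 + K * A)).
    rewrite -mulrDr -mulrA ler_wpM2l ?(ltW c_gt0)//.
    rewrite -[x1 in leRHS](simplex_sum_cst x1 w_simplex) /power_mean -big_split/= mulr_sumr.
    apply: ler_sum => i _; rewrite -mulrDr mulrCA ler_wpM2l ?w_simplex.1//.
    apply: le_trans (powRD_le (ltW p_gt0) (powR_ge0 _ _) (e_ge0 i)) _.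
    by rewrite powRK// ltW.
  have -> : K * A = x1 * t / 2 by rewrite /x1; field; rewrite gt_eqF.
  have : K * x1 <= x1 * t / 2 by rewrite mulrC -mulrA ler_wpM2l ?(ltW x10)//; lra.
  lra.
have x01 : x0 <= x1.
  rewrite leNgt; apply/negP => /(frailty_quantile_decr x10) h.
  by have := lt_le_trans (le_lt_trans h0 h) h1; rewrite ltxx.
have [||x xI Psix] := @IVT R Psi x0 x1 t x01.
- apply: continuous_in_subspaceT => y; rewrite inE/= in_itv/= => /andP[y0 _].
  exact/frailty_quantile_continuous/(lt_le_trans x00).
- apply/andP; split; [rewrite ge_min; apply/orP; right; exact: h1|].
  rewrite le_max; apply/orP; left; exact: h0.
move: xI; rewrite in_itv/= => /andP[x0x xx1].
have xpos := lt_le_trans x00 x0x.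
exists x; split => //.
apply/seteqP; split => y /=; rewrite in_itv/=.
  move=> [y0]; rewrite -/(frailty_quantile y) y0/= => ty.
  rewrite ltNge le_eqVlt; apply/negP => /predU1P[xy|].
    by move: ty; rewrite -xy Psix ltxx.
  by move=> /(frailty_quantile_decr xpos); rewrite Psix ltNge (ltW ty).
move=> /andP[y0 yx]; split; first exact: y0.
rewrite -Psix -/(frailty_quantile y); exact: frailty_quantile_decr y0 yx.
Qed.

End Threshold.

(** * Domination of the conditional remainder, uniformly in [t] *)

Section PointwiseTail.
Context {R : realType} {m : nat} (theta : R) (w e : 'I_m -> R).
Hypotheses (theta_gt0 : 0 < theta) (w_simplex : simplex w).
Hypothesis e_gt0 : forall i, 0 < e i.
Local Notation p := (1 / theta).
Local Notation u x i := (frailty_coord theta x (e i)).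
Local Notation a := (coef_a theta).
Local Notation b := (coef_b theta).
Local Notation c := (coef_c : R).
Local Notation L := (2 * (c * 2 `^ p)).
Local Notation A := (power_mean theta w e).

Let p_gt0 : 0 < p. Proof. by rewrite divr_gt0. Qed.
Let c_gt0 : 0 < c. Proof. by rewrite divr_gt0 ?pi_gt0. Qed.
Let A_gt0 : 0 < A. Proof. exact: power_mean_gt0. Qed.
Let L_gt0 : 0 < L. Proof. by rewrite mulr_gt0// mulr_gt0// powR_gt0. Qed.

Definition tail_remainder (kappa t : R) : R :=
  t `^ kappa * (t * fine (frailty_tail theta w t e) - a * c * A).

(* [x] is the frailty level at which the weighted sum equals [t], and [D] is
   [x - \int_0^x exp (- s ^ theta) ds]. *)
Definition threshold_data (t x D : R) : Prop :=
  [/\ 0 < x, t * x <= L * A,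
      t * x = c * \sum_i w i * (x `^ theta + e i) `^ p
              - x * \sum_i w i * cot_defect (u x i),
      expR (- (x `^ theta)) * (b * x `^ (theta + 1)) <= D <= b * x `^ (theta + 1) &
      frailty_tail theta w t e = (a * (x - D))%:E].

Lemma threshold_dataP t : L <= t -> exists xD : R * R, threshold_data t xD.1 xD.2.
Proof.
move=> Lt; have t0 := lt_le_trans L_gt0 Lt.
have [x [x0 xL xt Sx]] := frailty_threshold theta_gt0 w_simplex e_gt0 Lt.
have [D Db ID] := stretched_exp_defect theta_gt0 x0.
exists (x, D); split => //.
- by rewrite mulrC -ler_pdivlMr.
- rewrite -frailty_quantileE// xt mulrC; exact: erefl.
- rewrite /frailty_tail Sx; under eq_integral do rewrite EFinM.
  rewrite ge0_integralZl//=; last 2 first.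
  + apply/measurable_funTS/measurable_EFinP; apply: measurableT_comp => //.
    by apply: measurableT_comp => //; exact: measurable_powR.
  + by rewrite lee_fin ltW// coef_a_gt0.
  by rewrite ID.
Qed.

(** The three summands are the corrections due to the shift of [e_i], to the cotangent defect and to
    the decay of the frailty density; they are bounded separately. *)
Lemma tail_remainderE kappa t x D : threshold_data t x D ->
  tail_remainder kappa t =
  a * (c * (t `^ kappa * \sum_i w i * ((x `^ theta + e i) `^ p - e i `^ p))
       - t `^ kappa * (x * \sum_i w i * cot_defect (u x i))
       - t `^ kappa * (t * D)).
Proof.
move=> [_ _ txE _ tailE]; rewrite /tail_remainder tailE/=.
have -> : \sum_i w i * ((x `^ theta + e i) `^ p - e i `^ p) =
    \sum_i w i * (x `^ theta + e i) `^ p - A.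
  by rewrite /power_mean -sumrB; apply: eq_bigr => i _; rewrite mulrBr.
have -> : t * (a * (x - D)) = a * (t * x) - a * (t * D) by ring.
by rewrite txE; ring.
Qed.

(** At fixed exponentials, [B_w] without its factor [1 / theta]. *)
Definition power_mean_deriv : R := \sum_i w i * e i `^ (p - 1).
Definition power_mean_neg : R := \sum_i w i * e i `^ (- p).
Local Notation B' := power_mean_deriv.
Local Notation Q := power_mean_neg.

(** [A ^ (theta + 1)] dominates the curvature, [A] and [A ^ theta * B'] the shift, [A ^ 2 * Q] the
    defect. The last term enters only for [theta >= 2]: it need not be integrable when [theta <= 1],
    and below 2 the shift terms dominate the defect too. *)
Definition remainder_bound : R :=
  A `^ (theta + 1) + A + A `^ theta * B' + (if theta < 2 then 0 else A ^+ 2 * Q).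

Let B'_ge0 : 0 <= B'. Proof. by apply: simplex_sum_ge0 => // i; exact: powR_ge0. Qed.
Let Q_ge0 : 0 <= Q. Proof. by apply: simplex_sum_ge0 => // i; exact: powR_ge0. Qed.

Let bound_parts :
  [/\ 0 <= A `^ (theta + 1), 0 <= A, 0 <= A `^ theta * B' &
      0 <= if theta < 2 then 0 else A ^+ 2 * Q].
Proof.
split; rewrite ?powR_ge0 ?mulr_ge0 ?powR_ge0 ?(ltW A_gt0)//.
by case: ifP => // _; rewrite mulr_ge0 ?sqr_ge0.
Qed.

Lemma remainder_bound_ge0 : 0 <= remainder_bound.
Proof. by have [? ? ? ?] := bound_parts; rewrite !addr_ge0. Qed.

Section Bounds.
Variables kappa t x D : R.
Hypotheses (t_ge1 : 1 <= t) (kappa_le : kappa <= theta).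
Hypothesis xD : threshold_data t x D.

Let t_gt0 : 0 < t. Proof. exact: lt_le_trans t_ge1. Qed.
Let x_gt0 : 0 < x. Proof. by case: xD. Qed.
Let tx_gt0 : 0 < t * x. Proof. exact: mulr_gt0. Qed.
Let tx_le : t * x <= L * A. Proof. by case: xD. Qed.
Let LA_gt0 : 0 < L * A. Proof. exact: mulr_gt0. Qed.

(** The threshold [x] is controlled through [t * x <= L * A]. Giving [x ^ theta] its power of [t]
    leaves [t ^ (kappa - theta)], at most 1 for [t >= 1] and [kappa <= theta]. *)
Lemma scale_powR q : t `^ kappa * x `^ theta * q = t `^ (kappa - theta) * ((t * x) `^ theta * q).
Proof.
rewrite powRM ?(ltW t_gt0) ?(ltW x_gt0)// powRB ?(gt_eqF t_gt0) ?implybT//.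
by field; rewrite gt_eqF// powR_gt0.
Qed.

Let scale_le1 : t `^ (kappa - theta) <= 1.
Proof. by rewrite -[leRHS](powRr0 t) ler_powR// subr_le0. Qed.

Let tx_powR q : 0 <= q -> (t * x) `^ q <= L `^ q * A `^ q.
Proof.
move=> q0; rewrite -powRM ?(ltW L_gt0) ?(ltW A_gt0)//.
by apply: ge0_ler_powR; rewrite ?nnegrE// ltW.
Qed.

Let xt_le : x `^ theta <= (L * A) `^ theta.
Proof.
apply: ge0_ler_powR; rewrite ?nnegrE ?(ltW theta_gt0) ?(ltW x_gt0) ?(ltW LA_gt0)//.
by apply: le_trans tx_le; rewrite ler_peMl// ltW.
Qed.

(** Taking [rho = (L A) ^ theta] in [powR_shift_le] collapses the first product to [L A], because
    [theta + theta (p - 1) = 1]. *)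
Let shift_bound i :
  (t * x) `^ theta * (x `^ theta + e i) `^ (p - 1) <=
  2 `^ p * (L * A + L `^ theta * A `^ theta * e i `^ (p - 1)).
Proof.
have xt0 : 0 < x `^ theta by rewrite powR_gt0.
have h1 := powR_shift_le p_gt0 (e_gt0 i) xt0 xt_le.
have h2 := tx_powR (ltW theta_gt0).
apply: le_trans (ler_pM (powR_ge0 _ _) (powR_ge0 _ _) h2 h1) _.
rewrite mulrCA ler_wpM2l ?powR_ge0// mulrDr lerD2r.
rewrite -powRM ?(ltW L_gt0) ?(ltW A_gt0)// -powRrM -powRD ?(gt_eqF LA_gt0) ?implybT//.
have -> : theta + theta * (p - 1) = 1 by field; rewrite gt_eqF.
by rewrite powRr1// ltW.
Qed.

Let shift_sum_bound :
  \sum_i w i * ((t * x) `^ theta * (x `^ theta + e i) `^ (p - 1)) <=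
  2 `^ p * (L + L `^ theta) * remainder_bound.
Proof.
have [h1 h2 h3 h4] := bound_parts.
apply: (@le_trans _ _ (2 `^ p * (L * A + L `^ theta * (A `^ theta * B')))).
  apply: (le_trans (simplex_sum_le w_simplex shift_bound)).
  have -> : \sum_i w i * (2 `^ p * (L * A + L `^ theta * A `^ theta * e i `^ (p - 1))) =
      2 `^ p * (\sum_i w i * (L * A) + L `^ theta * (A `^ theta * B')).
    rewrite /power_mean_deriv !mulr_sumr -big_split/= mulr_sumr.
    by apply: eq_bigr => i _; ring.
  by rewrite simplex_sum_cst.
rewrite -[leRHS]mulrA ler_wpM2l ?powR_ge0// [leRHS]mulrDl.
have l0 : 0 <= L `^ theta by exact: powR_ge0.
apply: lerD; rewrite ler_wpM2l ?(ltW L_gt0)// /remainder_bound.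
  by move: h1 h2 h3 h4; set X1 := A `^ _; set X2 := _ * _; set X3 := (if _ then _ else _); lra.
by move: h1 h2 h3 h4; set X1 := A `^ _; set X2 := _ * _; set X3 := (if _ then _ else _); lra.
Qed.

(** By the mean value theorem each difference is [p xi ^ (p - 1) x ^ theta] with [xi] between [e_i]
    and [x ^ theta + e_i]; as [p - 1] has either sign, both ends are kept. *)
Lemma first_order_bound :
  0 <= t `^ kappa * \sum_i w i * ((x `^ theta + e i) `^ p - e i `^ p) <=
  p * (L `^ theta + 2 `^ p * (L + L `^ theta)) * remainder_bound.
Proof.
have [h1 h2 h3 h4] := bound_parts.
have xt0 : 0 < x `^ theta by rewrite powR_gt0.
have diff0 i : 0 <= (x `^ theta + e i) `^ p - e i `^ p.
  rewrite subr_ge0; apply: ge0_ler_powR; rewrite ?nnegrE ?(ltW p_gt0) ?(ltW (e_gt0 i)) ?addr_ge0 ?powR_ge0 ?(ltW (e_gt0 i))//.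
  by rewrite lerDr powR_ge0.
apply/andP; split; first by rewrite mulr_ge0 ?powR_ge0//; exact: simplex_sum_ge0.
apply: (@le_trans _ _ (\sum_i w i * (p * ((t * x) `^ theta * e i `^ (p - 1) +
    (t * x) `^ theta * (x `^ theta + e i) `^ (p - 1))))).
  rewrite mulr_sumr; apply: ler_sum => i _; rewrite mulrCA ler_wpM2l ?w_simplex.1//.
  have [xi /andP[exi xie] ->] := powR_diff p (e_gt0 i) xt0.
  have -> : t `^ kappa * (p * xi `^ (p - 1) * x `^ theta) =
      p * (t `^ kappa * x `^ theta * xi `^ (p - 1)) by ring.
  rewrite ler_wpM2l ?(ltW p_gt0)// scale_powR -mulrDr.
  apply: (@le_trans _ _ ((t * x) `^ theta * xi `^ (p - 1))).
    by rewrite ler_piMl// mulr_ge0 ?powR_ge0.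
  by rewrite ler_wpM2l ?powR_ge0// powR_between// ltW.
have -> : \sum_i w i * (p * ((t * x) `^ theta * e i `^ (p - 1) +
    (t * x) `^ theta * (x `^ theta + e i) `^ (p - 1))) =
   p * ((t * x) `^ theta * B' +
     \sum_i w i * ((t * x) `^ theta * (x `^ theta + e i) `^ (p - 1))).
  rewrite /power_mean_deriv mulr_sumr -big_split/= mulr_sumr.
  by apply: eq_bigr => i _; ring.
rewrite -[leRHS]mulrA ler_wpM2l ?(ltW p_gt0)// [leRHS]mulrDl; apply: lerD; last exact: shift_sum_bound.
apply: (@le_trans _ _ (L `^ theta * (A `^ theta * B'))).
  by rewrite mulrA ler_wpM2r// tx_powR// ltW.
rewrite ler_wpM2l ?powR_ge0// /remainder_bound.
by move: h1 h2 h3 h4; set X1 := A `^ _; set X2 := _ * _; set X3 := (if _ then _ else _); lra.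
Qed.

Lemma curvature_bound :
  0 <= t `^ kappa * (t * D) <= L `^ (theta + 1) * remainder_bound.
Proof.
have [h1 h2 h3 h4] := bound_parts.
have t1 : 0 <= theta + 1 by rewrite addr_ge0// ltW.
have b0 : 0 <= b by rewrite invr_ge0 addrC.
have b1 : b <= 1 by rewrite invf_le1 ?lerDl ?(ltW theta_gt0)// ltr_wpDr// ltW.
have [_ _ _ /andP[D0 D1] _] := xD.
have D0' : 0 <= D by apply: le_trans D0; rewrite !mulr_ge0 ?expR_ge0 ?powR_ge0.
have D2 : D <= x `^ (theta + 1).
  by apply: (le_trans D1); rewrite ler_piMl ?powR_ge0.
apply/andP; split; first by rewrite mulr_ge0 ?powR_ge0 ?mulr_ge0// ltW.
apply: (@le_trans _ _ (t `^ kappa * (t * x `^ (theta + 1)))).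
  by rewrite ler_wpM2l ?powR_ge0// ler_wpM2l// ltW.
have -> : t `^ kappa * (t * x `^ (theta + 1)) =
    t `^ (kappa - theta) * (t * x) `^ (theta + 1).
  have powRS y : 0 < y -> y `^ (theta + 1) = y `^ theta * y.
    by move=> y0; rewrite powRD ?(gt_eqF y0) ?implybT// powRr1// ltW.
  rewrite !powRS//.
  have -> : t `^ kappa * (t * (x `^ theta * x)) = t `^ kappa * x `^ theta * (t * x) by ring.
  by rewrite scale_powR.
apply: (@le_trans _ _ ((t * x) `^ (theta + 1))).
  by rewrite ler_piMl ?powR_ge0.
apply: (le_trans (tx_powR t1)); rewrite ler_wpM2l ?powR_ge0// /remainder_bound.
by move: h1 h2 h3 h4; set X1 := A `^ _; set X2 := _ * _; set X3 := (if _ then _ else _); lra.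
Qed.

(** For [theta < 2], [u <= u ^ (theta - 1)] on []0, 1]] bounds [t ^ theta x u] by [(t x) ^ theta (x
    ^ theta + e_i) ^ (p - 1)], already treated for the shift. For [theta >= 2], [t ^ 2 x u = (t x) ^
    2 (x ^ theta + e_i) ^ (- p)], and dropping [x ^ theta] leads to [A ^ 2 Q]. *)
Lemma defect_bound : kappa = Num.min theta 2 ->
  0 <= t `^ kappa * (x * \sum_i w i * cot_defect (u x i)) <=
  4 * (2 `^ p * (L + L `^ theta) + L ^+ 2) * remainder_bound.
Proof.
move=> kE; have [h1 h2 h3 h4] := bound_parts.
have phi i := cot_defect_coord theta_gt0 e_gt0 i x_gt0.
have u0 i : 0 < u x i by rewrite frailty_coord_gt0// ltW.
have u1 i : u x i <= 1 by rewrite frailty_coord_le1// ltW.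
have K0 : 0 <= 2 `^ p * (L + L `^ theta).
  by rewrite mulr_ge0 ?powR_ge0// addr_ge0 ?powR_ge0 ?(ltW L_gt0).
have rb0 := remainder_bound_ge0.
apply/andP; split.
  rewrite mulr_ge0 ?powR_ge0// mulr_ge0 ?(ltW x_gt0)//.
  by apply: simplex_sum_ge0 => // i; have /andP[] := phi i.
apply: (@le_trans _ _ (4 * \sum_i w i * (t `^ kappa * x * u x i))).
  rewrite mulrA !mulr_sumr; apply: ler_sum => i _.
  rewrite mulrCA [leRHS]mulrCA ler_wpM2l ?w_simplex.1//.
  have /andP[_ hi] := phi i.
  rewrite [leRHS]mulrCA ler_wpM2l// mulr_ge0 ?powR_ge0// ltW//.
rewrite -[leRHS]mulrA ler_wpM2l//.
have [t2|t2] := ltP theta 2.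
  have kt : kappa = theta by rewrite kE min_l// ltW.
  apply: (@le_trans _ _ (2 `^ p * (L + L `^ theta) * remainder_bound)); last first.
    by rewrite ler_wpM2r// lerDl sqr_ge0.
  apply: le_trans _ shift_sum_bound; apply: simplex_sum_le => // i.
  have xe0 : 0 < x `^ theta + e i by rewrite addr_gt0// powR_gt0.
  have ui : u x i <= u x i `^ (theta - 1).
    by apply: ger1_powR; [rewrite u0 u1|lra].
  apply: (@le_trans _ _ (t `^ kappa * x * u x i `^ (theta - 1))).
    by rewrite ler_wpM2l// mulr_ge0 ?powR_ge0// ltW.
  rewrite kt [in leLHS]/frailty_coord powRM ?powR_ge0 ?(ltW x_gt0)// -powRrM.
  have -> : - p * (theta - 1) = p - 1 by field; rewrite gt_eqF.
  rewrite powRM ?(ltW t_gt0) ?(ltW x_gt0)// !mulrA ler_wpM2r ?powR_ge0//.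
  by rewrite -mulrA mulr_powRB1// ltW.
have k2 : kappa = 2 by rewrite kE min_r.
apply: (@le_trans _ _ (L ^+ 2 * remainder_bound)); last first.
  by rewrite ler_wpM2r// lerDr.
apply: (@le_trans _ _ (\sum_i w i * ((L * A) ^+ 2 * e i `^ (- p)))).
  apply: simplex_sum_le => // i.
  rewrite k2 (powR_mulrn 2 (ltW t_gt0)).
  apply: (@le_trans _ _ ((t * x) ^+ 2 * e i `^ (- p))).
    have -> : t ^+ 2 * x * u x i = (t * x) ^+ 2 * (x `^ theta + e i) `^ (- p).
      by rewrite /frailty_coord; ring.
    rewrite ler_wpM2l ?sqr_ge0// ler_powRN ?oppr_le0 ?(ltW p_gt0)//.
    by rewrite lerDr powR_ge0.
  rewrite ler_wpM2r ?powR_ge0// lerXn2r// nnegrE; exact: ltW.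
have -> : \sum_i w i * ((L * A) ^+ 2 * e i `^ (- p)) = L ^+ 2 * (A ^+ 2 * Q).
  rewrite /power_mean_neg; move: L A => l k; rewrite !mulr_sumr.
  by apply: eq_bigr => i _; ring.
rewrite ler_wpM2l ?sqr_ge0// /remainder_bound ltNge t2/=.
by move: h1 h2 h3 h4; rewrite ltNge t2/=; set X1 := A `^ _; set X2 := _ * _; set X3 := _ * Q; lra.
Qed.

End Bounds.

End PointwiseTail.

(** * Pointwise limit of the conditional remainder *)

Section TailRemainder.
Context {R : realType} {m : nat} (theta : R) (w e : 'I_m -> R).
Hypotheses (theta_gt0 : 0 < theta) (w_simplex : simplex w).
Hypothesis e_gt0 : forall i, 0 < e i.
Local Notation p := (1 / theta).
Local Notation u x i := (frailty_coord theta x (e i)).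
Local Notation a := (coef_a theta).
Local Notation b := (coef_b theta).
Local Notation c := (coef_c : R).
Local Notation d := (coef_d : R).
Local Notation L := (2 * (c * 2 `^ p)).
Local Notation A := (power_mean theta w e).
Local Notation B' := (power_mean_deriv theta w e).
Local Notation Q := (power_mean_neg theta w e).

Let p_gt0 : 0 < p. Proof. by rewrite divr_gt0. Qed.
Let c_gt0 : 0 < c. Proof. by rewrite divr_gt0 ?pi_gt0. Qed.
Let A_gt0 : 0 < A. Proof. exact: power_mean_gt0. Qed.
Let L_gt0 : 0 < L. Proof. by rewrite mulr_gt0// mulr_gt0// powR_gt0. Qed.

Definition remainder_const : R :=
  a * (c * (p * (L `^ theta + 2 `^ p * (L + L `^ theta)))
       + 4 * (2 `^ p * (L + L `^ theta) + L ^+ 2) + L `^ (theta + 1)).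

Lemma tail_remainder_le t : 1 <= t -> L <= t ->
  `|tail_remainder theta w e (Num.min theta 2) t| <=
  remainder_const * remainder_bound theta w e.
Proof.
move=> t1 Lt; have [[x D]/= xD] := threshold_dataP theta_gt0 w_simplex e_gt0 Lt.
have kle : Num.min theta 2 <= theta by rewrite ge_min lexx.
have /andP[s10 s1] := first_order_bound theta_gt0 w_simplex e_gt0 t1 kle xD.
have /andP[s20 s2] := defect_bound theta_gt0 w_simplex e_gt0 t1 xD erefl.
have /andP[s30 s3] := curvature_bound theta_gt0 w_simplex e_gt0 t1 kle xD.
rewrite (tail_remainderE _ xD) normrM gtr0_norm ?coef_a_gt0//.
rewrite /remainder_const -mulrA ler_wpM2l ?(ltW (coef_a_gt0 theta_gt0))//.
apply: (le_trans (ler_normB _ _)); rewrite mulrDl; apply: lerD; last by rewrite ger0_norm.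
apply: (le_trans (ler_normB _ _)); rewrite mulrDl; apply: lerD; last by rewrite ger0_norm.
rewrite ger0_norm; last exact: mulr_ge0 (ltW c_gt0) s10.
by rewrite -[leRHS]mulrA; apply: ler_wpM2l s1; exact: ltW.
Qed.

Section Limit.
Variables kappa delta1 delta2 : R.
Hypothesis delta1P : t `^ (kappa - theta) @[t --> +oo] --> delta1.
Hypothesis delta2P : t `^ (kappa - 2) @[t --> +oo] --> delta2.

(** Everything reduces to [t * x --> c * A]. Each correction is then a product of a power of [t]
    with limit [delta1] or [delta2], a power of [t * x], and factors with known limits, built on the
    slope of [y ^ p] at [e_i], on [cot_defect u / u], or on [D / x ^ (theta + 1)]. *)
Lemma tail_remainder_cvg : tail_remainder theta w e kappa t @[t --> +oo] -->
  a * (c * (delta1 * ((c * A) `^ theta * (p * B')))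
       - delta2 * ((c * A) ^+ 2 * (d * Q))
       - delta1 * (b * (c * A) `^ (theta + 1))).
Proof.
have xD_ex t : exists xD : R * R, L <= t -> threshold_data theta w e t xD.1 xD.2.
  have [Lt|nLt] := leP L t; last by exists (0, 0).
  by have [xD h] := threshold_dataP theta_gt0 w_simplex e_gt0 Lt; exists xD.
have [xD xDP] := choice xD_ex.
pose x t := (xD t).1; pose D t := (xD t).2.
have nL : \forall t \near +oo, L <= t by exact: nbhs_pinfty_ge (num_real _).
have nP : \forall t \near +oo, threshold_data theta w e t (x t) (D t).
  by apply: filterS nL => t; exact: xDP.
have nt0 : \forall t \near +oo, 0 < t :> R by exact: nbhs_pinfty_gt (num_real _).
have nx0 : \forall t \near +oo, 0 < x t by apply: filterS nP => t [].
have inv0 : t^-1 @[t --> +oo] --> (0 : R).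
  by apply/gtr0_cvgV0; [exact: nt0|exact: cvg_id].
have x_cvg : x t @[t --> +oo] --> (0 : R).
  have h_cvg : L * A * t^-1 @[t --> +oo] --> (0 : R).
    by rewrite -(mulr0 (L * A)); apply: cvgM => //; exact: cvg_cst.
  apply: (squeeze_cvgr _ (cvg_cst 0) h_cvg).
  apply: filterS2 nP nt0 => t [x0 tx _ _ _] t0.
  by rewrite (ltW x0)/= ler_pdivlMr// mulrC.
have xr_cvg : x t @[t --> +oo] --> 0^'+ by exact: cvg_at_right_of_pos.
pose r t := x t `^ theta.
have r_cvg : r t @[t --> +oo] --> (0 : R).
  exact: (cvg_comp x (fun y => y `^ theta) xr_cvg (powR_cvg0 theta_gt0)).
have nr0 : \forall t \near +oo, 0 < r t.
  by apply: filterS nx0 => t x0; exact: powR_gt0.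
have rd_cvg : r t @[t --> +oo] --> 0^' by exact: cvg_dnbhs_of_pos.
have shift_cvg q i : (r t + e i) `^ q @[t --> +oo] --> e i `^ q.
  have h : r t + e i @[t --> +oo] --> e i.
    rewrite -[X in _ --> X]add0r; apply: cvgD => //; exact: cvg_cst.
  exact: (cvg_comp (fun t => r t + e i) (fun y => y `^ q) h (continuous_powR_pos (e_gt0 i))).
have slope_cvg i : ((r t + e i) `^ p - e i `^ p) / r t @[t --> +oo] --> p * e i `^ (p - 1).
  exact: (cvg_comp r (fun y => ((y + e i) `^ p - e i `^ p) / y) rd_cvg (@powR_slope_cvg R p _ (e_gt0 i))).
have nu0 i : \forall t \near +oo, 0 < u (x t) i.
  by apply: filterS nx0 => t x0; rewrite frailty_coord_gt0// ltW.
have u_cvg i : u (x t) i @[t --> +oo] --> (0 : R).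
  by rewrite -(mul0r (e i `^ (- p))); apply: cvgM => //; exact: shift_cvg.
have ur_cvg i : u (x t) i @[t --> +oo] --> 0^'+ by exact: cvg_at_right_of_pos.
have phi_cvg i : cot_defect (u (x t) i) / u (x t) i @[t --> +oo] --> d.
  exact: (cvg_comp (fun t => u (x t) i) (fun v => cot_defect v / v) (ur_cvg i) (@cot_defect_cvg R)).
pose y t := t * x t.
have y_cvg : y t @[t --> +oo] --> c * A.
  (* What is known to converge is the ratio of the defect to [u], so the defect is written as that
     ratio times [u], which tends to 0. *)
  pose g t := c * (\sum_i w i * (r t + e i) `^ p) -
    x t * (\sum_i w i * (cot_defect (u (x t) i) / u (x t) i * u (x t) i)).
  have gy : {near +oo, g =1 y}.
    near=> t; have tP : threshold_data theta w e t (x t) (D t) by near: t.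
    have [x0 _ txE _ _] := tP; rewrite /y txE /g; congr (_ - _ * _).
    by apply: eq_bigr => i _; rewrite divfK// gt_eqF// frailty_coord_gt0// ltW.
  apply: cvg_trans (near_eq_cvg gy) _.
  have -> : c * A = c * A - 0 * \sum_i w i * (d * 0) by rewrite mul0r subr0.
  apply: cvgB.
    apply: cvgM; first exact: cvg_cst.
    by apply: cvg_sum_ord => i; apply: cvgM; [exact: cvg_cst|exact: shift_cvg].
  apply: cvgM => //; apply: cvg_sum_ord => i; apply: cvgM; first exact: cvg_cst.
  by apply: cvgM.
have cA0 : 0 < c * A by rewrite mulr_gt0.
have yq_cvg q : y t `^ q @[t --> +oo] --> (c * A) `^ q.
  exact: (cvg_comp y (fun z => z `^ q) y_cvg (continuous_powR_pos cA0)).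
have D_cvg : D t / x t `^ (theta + 1) @[t --> +oo] --> b.
  have l_cvg : expR (- r t) * b @[t --> +oo] --> b.
    rewrite -[X in _ --> X]mul1r -expR0 -oppr0; apply: cvgM; last exact: cvg_cst.
    apply: (cvg_comp (fun t => - r t) expR _ (@continuous_expR R (- 0))).
    by apply: cvgN.
  apply: (squeeze_cvgr _ l_cvg (cvg_cst b)).
  apply: filterS nP => t [x0 _ _ /andP[l h] _].
  by rewrite ler_pdivlMr ?powR_gt0// ler_pdivrMr ?powR_gt0// -mulrA l h.
pose G t := a * (c * (t `^ (kappa - theta) * (y t `^ theta *
        (\sum_i w i * (((r t + e i) `^ p - e i `^ p) / r t))))
      - t `^ (kappa - 2) * (y t ^+ 2 *
        (\sum_i w i * (cot_defect (u (x t) i) / u (x t) i * (r t + e i) `^ (- p))))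
      - t `^ (kappa - theta) * (D t / x t `^ (theta + 1) * y t `^ (theta + 1))).
have GE : {near +oo, G =1 tail_remainder theta w e kappa}.
  near=> t; have t0 : 0 < t by near: t.
  have tP : threshold_data theta w e t (x t) (D t) by near: t.
  have [x0 _ _ _ _] := tP.
  rewrite (tail_remainderE kappa tP) /G; congr (_ * (_ * _ - _ - _)).
  - have t1 : 1 <= t by near: t; exact: nbhs_pinfty_ge (num_real _).
    rewrite -(scale_powR kappa t1 tP) -mulrA; congr (_ * _).
    rewrite mulr_sumr; apply: eq_bigr => i _; rewrite mulrCA; congr (_ * _).
    by rewrite mulrC divfK// gt_eqF// powR_gt0.
  - rewrite [LHS]mulrA.
    have -> : t `^ (kappa - 2) * y t ^+ 2 = t `^ kappa * (x t * x t).
      rewrite powRB ?(gt_eqF t0) ?implybT// (powR_mulrn 2 (ltW t0)) /y.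
      by field; rewrite gt_eqF.
    rewrite -!mulrA; congr (_ * (_ * _)).
    rewrite mulr_sumr; apply: eq_bigr => i _; rewrite mulrCA; congr (_ * _).
    rewrite mulrCA -/(frailty_coord theta (x t) (e i)) divfK// gt_eqF//.
    by rewrite frailty_coord_gt0// ltW.
  - have xt0 : x t `^ (theta + 1) != 0 by rewrite gt_eqF// powR_gt0.
    rewrite /y powRM ?(ltW t0) ?(ltW x0)//.
    have -> : D t / x t `^ (theta + 1) * (t `^ (theta + 1) * x t `^ (theta + 1)) =
        D t * t `^ (theta + 1) by field.
    rewrite [LHS]mulrCA [t * D t]mulrC [RHS]mulrCA; congr (_ * _).
    rewrite -powRD ?(gt_eqF t0) ?implybT//.
    have -> : kappa - theta + (theta + 1) = kappa + 1 by ring.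
    by rewrite powRD ?(gt_eqF t0) ?implybT// powRr1// ltW.
apply: cvg_trans (near_eq_cvg GE) _.
apply: cvgM; first exact: cvg_cst.
apply: cvgB; last first.
  by apply: cvgM => //; apply: cvgM.
apply: cvgB.
  apply: cvgM; first exact: cvg_cst.
  apply: cvgM => //; apply: cvgM => //.
  rewrite /power_mean_deriv mulr_sumr.
  apply: cvg_sum_ord => i; rewrite mulrCA; apply: cvgM; first exact: cvg_cst.
  exact: slope_cvg.
apply: cvgM => //; apply: cvgM.
  by rewrite expr2; under eq_cvg do rewrite expr2; apply: cvgM.
rewrite /power_mean_neg mulr_sumr.
apply: cvg_sum_ord => i; rewrite mulrCA; apply: cvgM; first exact: cvg_cst.
by apply: cvgM; [exact: phi_cvg|exact: shift_cvg].
Unshelve. all: by end_near.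
Qed.

End Limit.
End TailRemainder.

(** * Integration over the exponentials *)

(** Decoupling a product into separate powers of exponent above -1 reduces integrability to marginal
    moments. For [q < 0], comparing [x ^ s] with [y ^ (- delta)] either absorbs [x ^ s] into
    [y ^ (q - delta)] or bounds [y ^ q] by a power of [x]; [delta = (q + 1) / 2] puts [q - delta]
    halfway between [q] and -1. *)
Lemma powR_mul_bound (R : realType) (s q : R) : 0 <= s -> -1 < q ->
  exists s' q' : R, [/\ -1 < s', -1 < q' &
    forall x y : R, 0 < x -> 0 < y -> x `^ s * y `^ q <= x `^ s' + y `^ q'].
Proof.
move=> s0 q1; have [q0|q0] := leP 0 q.
  exists (s + q), (s + q); split; [lra|lra|move=> x y x0 y0].
  have D z : 0 < z -> z `^ (s + q) = z `^ s * z `^ q.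
    by move=> z0; rewrite powRD// (gt_eqF z0) implybT.
  have [xy|/ltW yx] := leP x y.
    apply: ler_wpDl; first exact: powR_ge0.
    rewrite D// ler_wpM2r ?powR_ge0//.
    by apply: ge0_ler_powR; rewrite ?nnegrE// ltW.
  apply: ler_wpDr; first exact: powR_ge0.
  rewrite D// ler_wpM2l ?powR_ge0//.
  by apply: ge0_ler_powR; rewrite ?nnegrE// ltW.
pose delta := (q + 1) / 2; have d0 : 0 < delta by rewrite /delta; lra.
have r0 : 0 <= - q / delta by rewrite divr_ge0// ?oppr_ge0 ltW.
exists (s + s * (- q / delta)), (q - delta); split.
- by rewrite (lt_le_trans _ (addr_ge0 s0 (mulr_ge0 s0 r0)))// ltrN10.
- by rewrite /delta; lra.
move=> x y x0 y0.
have [h|/ltW h] := leP (x `^ s) (y `^ (- delta)).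
  apply: ler_wpDl; first exact: powR_ge0.
  have -> : y `^ (q - delta) = y `^ (- delta) * y `^ q.
    by rewrite -powRD ?(gt_eqF y0) ?implybT// addrC.
  by rewrite ler_wpM2r ?powR_ge0.
apply: ler_wpDr; first exact: powR_ge0.
rewrite powRD ?(gt_eqF x0) ?implybT// ler_wpM2l ?powR_ge0// [in leRHS]powRrM.
have -> : y `^ q = (y `^ (- delta)) `^ (- q / delta).
  by rewrite -powRrM; congr (_ `^ _); field; rewrite gt_eqF.
by apply: ge0_ler_powR; rewrite ?nnegrE ?powR_ge0.
Qed.

(** A convex combination is at most its largest term, and the power of the largest is one of the
    summands on the right. *)
Lemma power_mean_powR_le (R : realType) (m : nat) (theta s : R) (w e : 'I_m -> R) :
  0 < theta -> simplex w -> (forall i, 0 < e i) -> 0 <= s ->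
  power_mean theta w e `^ s <= \sum_i e i `^ (s / theta).
Proof.
move=> t0 sw e0 s0; have [i0 _] := simplex_support sw.
case: (@arg_maxP _ _ _ i0 predT e erefl) => j _ ej.
have p0 : 0 <= 1 / theta by rewrite divr_ge0// ltW.
apply: (@le_trans _ _ (e j `^ (s / theta))); last first.
  by rewrite (bigD1 j)//= lerDl; apply: sumr_ge0 => i _; exact: powR_ge0.
apply: (@le_trans _ _ ((e j `^ (1 / theta)) `^ s)); last first.
  by rewrite -powRrM mulrAC mul1r.
apply: ge0_ler_powR; rewrite ?nnegrE ?powR_ge0//; first exact/ltW/power_mean_gt0.
rewrite -[leRHS](simplex_sum_cst _ sw); apply: simplex_sum_le => // i.
by apply: ge0_ler_powR; rewrite ?nnegrE ?(ltW (e0 _))//; exact: ej.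
Qed.

Section Integrability.
Context {R : realType} (m : nat) (theta : R) (w : 'I_m -> R).
Context d (T : measurableType d) (P : probability T R).
Variable E : 'I_m -> {RV P >-> R}.
Hypotheses (theta_gt0 : 0 < theta) (w_simplex : simplex w).
Hypothesis E_exp : forall i, has_law (E i) (exponential_prob 1).
Local Notation p := (1 / theta).

Lemma iid_exp1_gt0 : {ae P, forall o, forall i, 0 < E i o}.
Proof.
have h : forall i : 'I_m, \forall o \ae P, 0 < E i o by move=> i; exact: exp_law_gt0.
exact: filter_forall h.
Qed.

Lemma integrable_exp_powR i q : -1 < q ->
  P.-integrable setT (EFin \o (fun o => E i o `^ q)).
Proof.
move=> q1; apply/integrableP; split.
  by apply/measurable_EFinP; apply: (measurableT_comp (measurable_powR q)).
under eq_integral do rewrite /= ger0_norm ?powR_ge0//.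
by rewrite exp_law_moment// exp_moment_lty.
Qed.

Lemma measurable_simplex_sum q :
  measurable_fun setT (fun o => \sum_i w i * E i o `^ q).
Proof.
apply: measurable_sum => i; apply: measurable_funM => //.
by apply: (measurableT_comp (measurable_powR q)).
Qed.

(** Expanding both factors over the coordinates leaves products of two powers, to which
    [powR_mul_bound] applies, also on the diagonal. The exponents needed are [q = p - 1], [q = - p]
    and [q = 0]. *)
Lemma integrable_mean_product s q : 0 <= s -> -1 < q ->
  P.-integrable setT (EFin \o (fun o =>
    power_mean theta w (fun i => E i o) `^ s * \sum_i w i * E i o `^ q)).
Proof.
move=> s0 q1.
have st0 : 0 <= s / theta by rewrite divr_ge0// ltW.
have [s' [q' [s'1 q'1 le_sq]]] := powR_mul_bound st0 q1.
pose g o := \sum_(i < m) \sum_(j < m) (E i o `^ s' + E j o `^ q').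
have g0 o : 0 <= g o.
  by apply: sumr_ge0 => i _; apply: sumr_ge0 => j _; rewrite addr_ge0 ?powR_ge0.
have ig : P.-integrable setT (EFin \o g).
  have -> : EFin \o g = fun o =>
      (\sum_(i < m) \sum_(j < m) ((E i o `^ s')%:E + (E j o `^ q')%:E))%E.
    apply/funext => o /=; rewrite /g -sumEFin; apply: eq_bigr => i _.
    by rewrite -sumEFin; apply: eq_bigr => j _; rewrite EFinD.
  apply: integrable_sum => // i _; apply: integrable_sum => // j _.
  by apply: integrableD => //; exact: integrable_exp_powR.
have w0 := w_simplex.1.
have w1 i : w i <= 1.
  by rewrite -w_simplex.2 (bigD1 i)//= lerDl; apply: sumr_ge0 => j _.
set f := fun o => _ * _.
have f0 o : 0 <= f o.
  by rewrite mulr_ge0 ?powR_ge0//; apply: simplex_sum_ge0 => // i; exact: powR_ge0.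
have mf : measurable_fun setT (EFin \o f).
  apply/measurable_EFinP; apply: measurable_funM; last exact: measurable_simplex_sum.
  by apply: (measurableT_comp (measurable_powR s)); exact: measurable_simplex_sum.
apply/integrableP; split => //.
have /integrableP[mg] := ig; apply: le_lt_trans.
apply: ae_ge0_le_integral => //.
- exact: measurableT_comp.
- exact: measurableT_comp.
apply: filterS iid_exp1_gt0 => o e0 _ /=; rewrite lee_fin !ger0_norm//.
apply: (@le_trans _ _ ((\sum_i E i o `^ (s / theta)) * \sum_j E j o `^ q)).
  apply: ler_pM; rewrite ?powR_ge0//.
  - by apply: simplex_sum_ge0 => // i; exact: powR_ge0.
  - exact: power_mean_powR_le.
  - by apply: ler_sum => i _; rewrite ler_piMl ?powR_ge0.
rewrite mulr_suml; apply: ler_sum => i _; rewrite mulr_sumr; apply: ler_sum => j _.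
exact: le_sq.
Qed.

(** Since [coef_a] is the inverse of this value, [a c A] has mean [c], the leading coefficient. *)
Lemma exp_power_mean :
  (\int[P]_o (power_mean theta w (fun i => E i o))%:E = (Gamma (1 + p))%:E)%E.
Proof.
have p1 : -1 < p by rewrite (lt_le_trans (ltrN10 _))// divr_ge0// ltW.
rewrite /power_mean.
under eq_integral do rewrite -sumEFin; rewrite integral_sum//=; last first.
  move=> i; under eq_fun do rewrite EFinM.
  by apply: integrableZl => //; exact: integrable_exp_powR.
transitivity (\sum_i (w i)%:E * (Gamma (1 + p))%:E)%E.
  apply: eq_bigr => i _; under eq_integral do rewrite EFinM.
  by rewrite integralZl ?exp_law_moment ?GammaE//; exact: integrable_exp_powR.
under eq_bigr do rewrite -EFinM.
by rewrite sumEFin simplex_sum_cst.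
Qed.

End Integrability.

Lemma coef_aGamma (R : realType) (theta : R) : 0 < theta ->
  coef_a theta * Gamma (1 + 1 / theta) = 1.
Proof.
move=> theta0; apply: mulVf; apply: lt0r_neq0; apply: Gamma_gt0.
exact: divr_gt0.
Qed.

(** * Dominated convergence over the exponentials *)

Section TailExpansion.
Context {R : realType} (m : nat) (theta : R) (w : 'I_m -> R).
Context dU (TU : measurableType dU) (PU : probability TU R).
Variable U : 'I_m -> {RV PU >-> R}.
Context dE (TE : measurableType dE) (PE : probability TE R).
Variable E : 'I_m -> {RV PE >-> R}.
Hypotheses (theta_gt0 : 0 < theta) (w_simplex : simplex w).
Hypothesis U_unif : forall i, has_law (U i) (uniform_prob (@ltr01 R)).
Hypothesis U_clayton : has_copula U (@clayton R theta m).
Hypothesis E_iid : iid_exp1 E.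
Local Notation p := (1 / theta).
Local Notation a := (coef_a theta).
Local Notation b := (coef_b theta).
Local Notation c := (coef_c : R).
Local Notation d := (coef_d : R).
Local Notation L := (2 * (c * 2 `^ p)).
Local Notation A o := (power_mean theta w (fun i => E i o)).
Local Notation B' o := (power_mean_deriv theta w (fun i => E i o)).
Local Notation Q o := (power_mean_neg theta w (fun i => E i o)).

Let E_exp := E_iid.2.
Let E_gt0 := iid_exp1_gt0 E_exp.
Let c_gt0 : 0 < c. Proof. by rewrite divr_gt0 ?pi_gt0. Qed.
Let L_gt0 : 0 < L. Proof. by rewrite mulr_gt0// mulr_gt0// powR_gt0. Qed.

Lemma A_ge0 o : 0 <= A o.
Proof. by apply: simplex_sum_ge0 => // i; exact: powR_ge0. Qed.

Lemma measurable_A : measurable_fun setT (fun o => A o).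
Proof. exact: measurable_simplex_sum. Qed.

Lemma integrable_A_powR s : 0 <= s ->
  PE.-integrable setT (EFin \o (fun o => A o `^ s)).
Proof.
move=> s0; have := integrable_mean_product theta_gt0 w_simplex E_exp s0 (ltrN10 R).
apply: eq_integrable => // o _ /=.
by under eq_bigr do rewrite powRr0; rewrite (simplex_sum_cst _ w_simplex) mulr1.
Qed.

Lemma integrable_A : PE.-integrable setT (EFin \o (fun o => A o)).
Proof.
have := integrable_A_powR ler01; apply: eq_integrable => // o _ /=.
by rewrite powRr1// A_ge0.
Qed.

Lemma integrable_remainder_bound :
  PE.-integrable setT (EFin \o (fun o => remainder_bound theta w (fun i => E i o))).
Proof.
have t1 : 0 <= theta + 1 by rewrite addr_ge0// ltW.
have p1 : -1 < p - 1 by rewrite ltrBDl subrr divr_gt0.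
have iB := integrable_mean_product theta_gt0 w_simplex E_exp (ltW theta_gt0) p1.
have iQ : PE.-integrable setT (EFin \o (fun o => if theta < 2 then 0 else A o ^+ 2 * Q o)).
  case: ltP => t2; first exact: integrable0.
  have np1 : -1 < - p by rewrite ltrN2 ltr_pdivrMr// mul1r; lra.
  have := integrable_mean_product theta_gt0 w_simplex E_exp (ler0n R 2) np1.
  by apply: eq_integrable => // o _ /=; rewrite powR_mulrn// A_ge0.
have h := integrableD measurableT (integrableD measurableT (integrableD measurableT
  (integrable_A_powR t1) integrable_A) iB) iQ.
exact: h.
Qed.

(* The absolute value changes [E] on a null set only, and makes the
   Marshall-Olkin representation valid everywhere. *)
Let remainder (kappa t : R) (o : TE) : R :=
  t `^ kappa * (t * fine (frailty_tail theta w t (fun i => `|E i o|)) - a * c * A o).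

Let remainderE : {ae PE, forall o, (forall i, 0 < E i o) /\ forall kappa t,
  remainder kappa t o = tail_remainder theta w (fun i => E i o) kappa t}.
Proof.
apply: filterS E_gt0 => o E0; split; [exact: E0|move=> kappa t].
have eE : (fun i => `|E i o|) = fun i => E i o.
  by apply/funext => i; apply: gtr0_norm; exact: E0.
by rewrite /remainder /tail_remainder eE.
Qed.

Let measurable_tail t : measurable_fun setT
  (fun o => fine (frailty_tail theta w t (fun i => `|E i o|))).
Proof. by apply: measurableT_comp => //; exact: measurable_frailty_tail. Qed.

Let measurable_remainder kappa t : measurable_fun setT (remainder kappa t).
Proof.
apply: measurable_funM => //; apply: measurable_funB; first exact: measurable_funM.
by apply: measurable_funM => //; exact: measurable_A.
Qed.

(** For [t >= L] the threshold makes the conditional tail finite almost surely, so that [fine]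
    preserves its integral. *)
Let integral_remainder kappa t : L <= t ->
  (\int[PE]_o (remainder kappa t o)%:E)%E = (t `^ kappa * (t * sum_tail w U t - c))%:E.
Proof.
move=> Lt.
pose F o := fine (frailty_tail theta w t (fun i => `|E i o|)).
have tail_ge0 e : (0 <= frailty_tail theta w t e)%E.
  apply: integral_ge0 => x _.
  by rewrite lee_fin mulr_ge0 ?expR_ge0// ltW// coef_a_gt0.
have mtail := measurable_frailty_tail w E theta_gt0 t.
have F_int : (\int[PE]_o (F o)%:E = (sum_tail w U t)%:E)%E.
  rewrite (sum_tail_frailty w theta_gt0 U_unif U_clayton E_iid t).
  apply: ge0_ae_eq_integral => //.
  - by apply/measurable_EFinP; exact: measurable_tail.
  - by move=> o _; rewrite lee_fin fine_ge0.
  apply: filterS E_gt0 => o E0 _.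
  have E0' i : 0 < `|E i o| by rewrite gtr0_norm.
  have [[x D]/= [_ _ _ _ tE]] := threshold_dataP theta_gt0 w_simplex E0' Lt.
  by rewrite /F tE.
have iF : PE.-integrable setT (EFin \o F).
  apply/integrableP; split; first by apply/measurable_EFinP; exact: measurable_tail.
  under eq_integral do rewrite /= ger0_norm ?fine_ge0//.
  by rewrite F_int ltry.
have iA := integrable_A.
under eq_integral do rewrite /remainder EFinM.
rewrite integralZl//; last first.
  have -> : (fun o => (t * F o - a * c * A o)%:E) =
    (fun o => (t%:E * (F o)%:E - (a * c)%:E * (A o)%:E)%E) by [].
  by apply: integrableB => //; exact: integrableZl.
have -> : (\int[PE]_o (t * F o - a * c * A o)%:E)%E =
    (\int[PE]_o (t%:E * (F o)%:E - (a * c)%:E * (A o)%:E))%E by [].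
rewrite integralB//; [|exact: integrableZl..].
rewrite !integralZl// F_int exp_power_mean// -!EFinM.
by rewrite mulrAC coef_aGamma// mul1r.
Qed.

(* [delta1] and [delta2] are the limits of [t ^ (kappa - theta)] and
   [t ^ (kappa - 2)], where [kappa] is the minimum of [theta] and [2]: they select
   the corrections that survive in the second term. *)
Definition limit_integrand (delta1 delta2 : R) (o : TE) : R :=
  a * (c * (delta1 * ((c * A o) `^ theta * (p * B' o)))
       - delta2 * ((c * A o) ^+ 2 * (d * Q o))
       - delta1 * (b * (c * A o) `^ (theta + 1))).

Lemma measurable_limit_integrand delta1 delta2 :
  measurable_fun setT (limit_integrand delta1 delta2).
Proof.
have mA := measurable_A.
have mcA : measurable_fun setT (fun o => c * A o) by exact: measurable_funM.
have mp q : measurable_fun setT (fun o => (c * A o) `^ q).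
  exact: (measurableT_comp (measurable_powR q)).
apply: measurable_funM => //; apply: measurable_funB; first apply: measurable_funB.
- apply: measurable_funM => //; apply: measurable_funM => //; apply: measurable_funM => //.
  by apply: measurable_funM => //; exact: measurable_simplex_sum.
- apply: measurable_funM => //; apply: measurable_funM; first exact: measurable_funX.
  by apply: measurable_funM => //; exact: measurable_simplex_sum.
- by apply: measurable_funM => //; apply: measurable_funM.
Qed.

Lemma sum_tail_cvg (delta1 delta2 : R) :
  t `^ (Num.min theta 2 - theta) @[t --> +oo] --> delta1 ->
  t `^ (Num.min theta 2 - 2) @[t --> +oo] --> delta2 ->
  t `^ (Num.min theta 2) * (t * sum_tail w U t - c) @[t --> +oo] -->
  fine (\int[PE]_o (limit_integrand delta1 delta2 o)%:E)%E.
Proof.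
move=> d1P d2P; set kappa := Num.min theta 2.
apply/cvg_pinftyP => u0 u0oo.
(* Dominated convergence is about sequences. Raising the sequence to at least [T0] makes the bounds
   hold at every index and alters only finitely many terms. *)
pose T0 := Num.max 1 L.
pose u n := Num.max (u0 n) T0.
have uT0 n : T0 <= u n by rewrite le_max lexx orbT.
have u1 n : 1 <= u n by rewrite (le_trans _ (uT0 n))// le_max lexx.
have uL n : L <= u n by rewrite (le_trans _ (uT0 n))// le_max lexx orbT.
have uE : \forall n \near \oo, u n = u0 n.
  have /cvgryPge/(_ T0) := u0oo; apply: filterS => n h.
  by rewrite /u max_l.
have uoo : u n @[n --> \oo] --> +oo.
  by apply: cvg_trans u0oo; apply: near_eq_cvg; apply: filterS uE.
suff H : u n `^ kappa * (u n * sum_tail w U (u n) - c) @[n --> \oo] -->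
    fine (\int[PE]_o (limit_integrand delta1 delta2 o)%:E)%E.
  apply: cvg_trans H; apply: near_eq_cvg; apply: filterS uE => n /= ->.
  by [].
have [||||| il _ H] := @dominated_convergence _ _ _ PE setT measurableT
  (fun n o => (remainder kappa (u n) o)%:E)
  (fun o => (limit_integrand delta1 delta2 o)%:E)
  (fun o => (remainder_const theta)%:E * (remainder_bound theta w (fun i => E i o))%:E)%E.
- by move=> n; apply/measurable_EFinP.
- by apply/measurable_EFinP; exact: measurable_limit_integrand.
- apply: filterS remainderE => o [E0 rE] _.
  apply: cvg_EFin; first exact: nearW.
  have h := tail_remainder_cvg theta_gt0 w_simplex E0 d1P d2P.
  have hu := (cvg_pinftyP _ _).1 h u uoo.
  apply: cvg_trans hu; apply: near_eq_cvg; apply: nearW => n /=.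
  exact: esym (rE _ _).
- by apply: integrableZl => //; exact: integrable_remainder_bound.
- apply: filterS remainderE => o [E0 rE] n _; rewrite -EFinM lee_fin rE.
  exact: (tail_remainder_le theta_gt0 w_simplex E0 (u1 n) (uL n)).
have i n : (\int[PE]_o (remainder kappa (u n) o)%:E)%E =
    (u n `^ kappa * (u n * sum_tail w U (u n) - c))%:E by exact: integral_remainder.
have {i}H : (u n `^ kappa * (u n * sum_tail w U (u n) - c))%:E @[n --> \oo] -->
    (\int[PE]_o (limit_integrand delta1 delta2 o)%:E)%E.
  by apply: cvg_trans H; apply: near_eq_cvg; apply: nearW => n; exact: i.
have lfin : (\int[PE]_o (limit_integrand delta1 delta2 o)%:E)%E \is a fin_num.
  exact: (integrable_fin_num measurableT il).
move: H; rewrite -[in X in X -> _](fineK lfin) => /fine_cvg.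
exact.
Qed.

End TailExpansion.

Lemma powR_mulr1 (R : realType) (x s : R) : 0 <= x -> 0 <= s ->
  x `^ s * x = x `^ (s + 1).
Proof.
move=> x0 s0; have s1 : 0 < s + 1 by exact: ltr_wpDl.
by rewrite mulrC -[in LHS](addrK 1 s) mulr_powRB1.
Qed.

Section LimitIntegral.
Context {R : realType} (m : nat) (theta : R) (w : 'I_m -> R).
Context dE (TE : measurableType dE) (PE : probability TE R).
Variable E : 'I_m -> {RV PE >-> R}.
Hypotheses (theta_gt0 : 0 < theta) (w_simplex : simplex w).
Hypothesis E_iid : iid_exp1 E.
Local Notation p := (1 / theta).
Local Notation a := (coef_a theta).
Local Notation b := (coef_b theta).
Local Notation c := (coef_c : R).
Local Notation d := (coef_d : R).
Local Notation A o := (power_mean theta w (fun i => E i o)).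
Local Notation B' o := (power_mean_deriv theta w (fun i => E i o)).
Local Notation Q o := (power_mean_neg theta w (fun i => E i o)).

Let E_exp := E_iid.2.

Let A0 o : 0 <= A o.
Proof. by apply: simplex_sum_ge0 => // i; exact: powR_ge0. Qed.

Lemma D_integrandE o : D_integrand theta w E o =
  p * (A o `^ theta * B' o) - b * A o `^ (theta + 1).
Proof.
rewrite -powR_mulr1//; last exact: ltW.
rewrite [LHS]mulrBr; congr (_ - _); first by rewrite mulrCA.
by rewrite mulrCA.
Qed.

Lemma integrable_D_integrand :
  PE.-integrable setT (EFin \o D_integrand theta w E).
Proof.
have t1 : 0 <= theta + 1 by rewrite addr_ge0// ltW.
have p1 : -1 < p - 1 by rewrite ltrBDl subrr divr_gt0.
have iB := integrable_mean_product theta_gt0 w_simplex E_exp (ltW theta_gt0) p1.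
have iA := integrable_A_powR theta_gt0 w_simplex E_iid t1.
have h := integrableB measurableT (integrableZl measurableT p iB)
  (integrableZl measurableT b iA).
by apply: eq_integrable h => // o _ /=; rewrite D_integrandE EFinB !EFinM.
Qed.

Lemma integrable_A2Q : 2 <= theta -> PE.-integrable setT (EFin \o A2Q theta w E).
Proof.
move=> t2.
have np1 : -1 < - p by rewrite ltrN2 ltr_pdivrMr// mul1r; lra.
have := integrable_mean_product theta_gt0 w_simplex E_exp (ler0n R 2) np1.
by apply: eq_integrable => // o _ /=; rewrite powR_mulrn.
Qed.

Lemma limit_integrandE delta1 delta2 o :
  limit_integrand theta w E delta1 delta2 o =
  delta1 * (a * c `^ (1 + theta)) * D_integrand theta w E o
  - delta2 * (a * d * c ^+ 2) * A2Q theta w E o.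
Proof.
have c0 : 0 < c by rewrite divr_gt0 ?pi_gt0.
rewrite D_integrandE /limit_integrand /A2Q (_ : A_w theta w E o = A o)// (_ : Q_w theta w E o = Q o)//.
move: (c) c0 => k k0; have k0' := ltW k0; have th0 := ltW theta_gt0.
rewrite !powRM// exprMn (addrC 1 theta) -!powR_mulr1//.
move: (A o) (k `^ theta) (B' o) (Q o) a b d p.
by move=> x ? ? ? ? ? ? ?; move: (x `^ theta) => ?; ring.
Qed.

(** The disjunction reflects the integrability of [A2Q]: either its coefficient vanishes before
    integration, or [theta >= 2] makes it integrable. *)
Lemma limit_integral delta1 delta2 : delta2 = 0 \/ 2 <= theta ->
  fine (\int[PE]_o (limit_integrand theta w E delta1 delta2 o)%:E)%E =
  delta1 * (c `^ (1 + theta) * D_w theta w E)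
  - delta2 * (a * d * c ^+ 2 * fine ('E_PE[A2Q theta w E])%E).
Proof.
move=> h; rewrite /D_w !expectation.unlock.
under eq_integral do rewrite limit_integrandE EFinB !(EFinM (_ * _)).
have iD := integrable_D_integrand.
have fD := integrable_fin_num measurableT iD.
have iD' : PE.-integrable setT (fun o => (delta1 * (a * c `^ (1 + theta)))%:E *
    (D_integrand theta w E o)%:E)%E by exact: integrableZl.
have [->|t2] := h.
  rewrite !mul0r subr0.
  under eq_integral do rewrite mul0e sube0.
  rewrite integralZl// -(fineK fD) -EFinM /=.
  by rewrite -mulrA (mulrC a) -mulrA.
have iA := integrable_A2Q t2; have fA := integrable_fin_num measurableT iA.
rewrite integralB//; last exact: integrableZl.
rewrite !integralZl// -(fineK fD) -(fineK fA) -!EFinM /=.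
by rewrite -[in LHS]mulrA (mulrC a (c `^ _)) -!mulrA.
Qed.

End LimitIntegral.

Lemma cvg_powR_pinfty0 (R : realType) (q : R) : q < 0 ->
  t `^ q @[t --> +oo] --> (0 : R).
Proof.
move=> q0; have r0 : 0 < - q by rewrite oppr_gt0.
apply/cvgr0Pnorm_lt => eps eps0.
near=> t.
have t0 : 0 < t by near: t; exact: nbhs_pinfty_gt.
have te : eps^-1 `^ (- q)^-1 < t by near: t; exact: nbhs_pinfty_gt.
rewrite ger0_norm ?powR_ge0// -(opprK q) powRN.
rewrite -(invrK eps) ltf_pV2 ?posrE ?invr_gt0 ?powR_gt0//.
have -> : eps^-1 = (eps^-1 `^ (- q)^-1) `^ (- q).
  by rewrite -powRrM mulVf ?gt_eqF// powRr1// invr_ge0 ltW.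
by apply: gt0_ltr_powR => //; rewrite nnegrE ?powR_ge0// ltW.
Unshelve. all: by end_near. Qed.

(** Since [e t * t ^ kappa = 1 / t], the error is [e t] times the deviation of the rescaled
    remainder from its limit [l]. Prescribing [e] only near infinity admits the integer power
    [t ^- 3]. *)
Lemma expansion_littleo (R : realType) (S e : R -> R) (k kappa l : R) :
  t `^ kappa * (t * S t - k) @[t --> +oo] --> l ->
  (\forall t \near +oo, e t = t `^ (- 1 - kappa)) ->
  forall t, S t = (k / t + l * e t) +o_(t \near +oo) (e t).
Proof.
move=> Sl eE.
suff H : S = (fun t => k / t + l * e t) +o_ (nbhs +oo) e by move=> t; exact: (congr1 (@^~ t) H).
apply/eqaddoP => eps eps0.
move/cvgrPdist_le : Sl => /(_ eps eps0) Sl.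
near=> t.
have t0 : 0 < t by near: t; exact: nbhs_pinfty_gt.
have tE : e t = t `^ (-1 - kappa) by near: t.
have -> : (S - (fun t => k / t + l * e t)) t = - (e t * (l - t `^ kappa * (t * S t - k))).
  have -> : (S - (fun t => k / t + l * e t)) t = S t - (k / t + l * e t) by [].
  have h : e t * t `^ kappa = t^-1.
    have tn : (-1 - kappa + kappa == 0) ==> (t != 0) by rewrite (gt_eqF t0) implybT.
    by rewrite tE -(powRD tn) subrK -powR_inv1// ltW.
  have t1 : t^-1 * t = 1 by rewrite mulVf// gt_eqF.
  rewrite mulrBr (mulrA (e t) (t `^ kappa)) h mulrBr (mulrA t^-1) t1.
  by ring.
by rewrite normrN normrM mulrC ler_wpM2r//; near: t.
Unshelve. all: by end_near. Qed.

(** * The three regimes of [theta] *)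

Section Expansion.
Context {R : realType} (m : nat) (theta : R) (w : 'I_m -> R).
Context dU (TU : measurableType dU) (PU : probability TU R).
Variable U : 'I_m -> {RV PU >-> R}.
Context dE (TE : measurableType dE) (PE : probability TE R).
Variable E : 'I_m -> {RV PE >-> R}.
Hypotheses (theta_gt0 : 0 < theta) (w_simplex : simplex w).
Hypothesis U_unif : forall i, has_law (U i) (uniform_prob (@ltr01 R)).
Hypothesis U_clayton : has_copula U (@clayton R theta m).
Hypothesis E_iid : iid_exp1 E.
Local Notation a := (coef_a theta).
Local Notation c := (coef_c : R).
Local Notation d := (coef_d : R).
Local Notation D := (D_w theta w E).
Local Notation EA2Q := (fine ('E_PE[A2Q theta w E])%E).

Let power_cvg q : q = 0 -> t `^ q @[t --> +oo] --> (1 : R).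
Proof. by move=> ->; under eq_cvg do rewrite powRr0; exact: cvg_cst. Qed.

Let cube_near : \forall t \near (+oo : set_system R), t ^- 3 = t `^ (- 1 - 2).
Proof.
near=> t; have t0 : 0 <= t by near: t; exact: nbhs_pinfty_ge.
by rewrite -opprD powRN -powR_mulrn// -natr1 addrC.
Unshelve. all: by end_near. Qed.

Lemma expansion_lt2 : theta < 2 -> forall t, sum_tail w U t =
  (c / t + c `^ (1 + theta) * D * t `^ (- 1 - theta))
  +o_(t \near +oo) (t `^ (- 1 - theta)).
Proof.
move=> t2; apply: (@expansion_littleo _ _ (fun t => t `^ (- 1 - theta)) c theta); last exact: nearW.
have k : Num.min theta 2 = theta by rewrite min_l// ltW.
have := @sum_tail_cvg _ _ theta w _ _ _ U _ _ _ E theta_gt0 w_simplex U_unif U_clayton E_iid 1 0.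
rewrite k subrr limit_integral//; last by left.
rewrite mul1r mul0r subr0; apply; first exact: power_cvg.
by apply: cvg_powR_pinfty0; rewrite subr_lt0.
Qed.

Lemma expansion_eq2 : theta = 2 -> forall t, sum_tail w U t =
  (c / t + (c ^+ 3 * D - a * d * c ^+ 2 * EA2Q) * t ^- 3) +o_(t \near +oo) (t ^- 3).
Proof.
move=> t2; apply: (@expansion_littleo _ _ (fun t => t ^- 3) c 2); last exact: cube_near.
have k : Num.min theta 2 = 2 by rewrite min_r// t2.
have := @sum_tail_cvg _ _ theta w _ _ _ U _ _ _ E theta_gt0 w_simplex U_unif U_clayton E_iid 1 1.
rewrite k limit_integral//; last by right; rewrite t2.
rewrite !mul1r.
have -> : c `^ (1 + theta) = c ^+ 3.
  have c0 : 0 <= c by rewrite ltW// divr_gt0 ?pi_gt0.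
  by rewrite -powR_mulrn// t2 addrC natr1.
by apply; apply: power_cvg; rewrite ?t2 subrr.
Qed.

Lemma expansion_gt2 : 2 < theta -> forall t, sum_tail w U t =
  (c / t + (- a * d * c ^+ 2 * EA2Q) * t ^- 3) +o_(t \near +oo) (t ^- 3).
Proof.
move=> t2; apply: (@expansion_littleo _ _ (fun t => t ^- 3) c 2); last exact: cube_near.
have k : Num.min theta 2 = 2 by rewrite min_r// ltW.
have := @sum_tail_cvg _ _ theta w _ _ _ U _ _ _ E theta_gt0 w_simplex U_unif U_clayton E_iid 0 1.
rewrite k limit_integral//; last by right; exact: ltW.
rewrite mul1r mul0r sub0r !mulNr; apply; last by apply: power_cvg; rewrite subrr.
by apply: cvg_powR_pinfty0; rewrite subr_lt0.
Qed.

End Expansion.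

(** * One active coordinate *)

Lemma one_active_sum (R : realType) (m : nat) (w : 'I_m -> R) : simplex w ->
  #|[pred i | w i != 0]| = 1%N ->
  exists i0, forall f : 'I_m -> R, \sum_i w i * f i = f i0.
Proof.
move=> [_ w1] /mem_card1[i0 iP]; exists i0.
have w0 i : i != i0 -> w i = 0.
  by move=> ii; have := iP i; rewrite !inE (negPf ii) => /negbFE/eqP.
have sumE f : \sum_i w i * f i = w i0 * f i0.
  rewrite (bigD1 i0)//= big1 ?addr0// => i ii.
  by rewrite w0// mul0r.
have w01 : w i0 = 1.
  rewrite -w1 -[RHS](eq_bigr _ (fun i _ => mulr1 (w i))).
  by rewrite (sumE (fun=> 1)) mulr1.
by move=> f; rewrite sumE w01 mul1r.
Qed.

Lemma measurable_cot_half (R : realType) :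
  measurable_fun setT (fun u : R => cot (pi * u / 2)).
Proof.
apply: (measurableT_comp (@measurable_cot R)).
by apply: measurable_funM => //; exact: measurable_funM.
Qed.

Lemma cot_gtE (R : realType) (t u : R) : 0 < t -> 0 < u <= 1 ->
  (t < cot (pi * u / 2)) = (u < 2 / pi * atan (1 / t)).
Proof.
move=> t0 u01; have [/andP[x0 _] xpi] := half_angle u01.
have y0 : 0 < atan (1 / t) by rewrite -(atan0 R) lt_atan// divr_gt0.
have ypi : atan (1 / t) < pi.
  by rewrite (lt_le_trans (atan_ltpi2 _))// ler_pdivrMr// ler_peMr ?pi_ge0// ler1n.
have ct : cot (atan (1 / t)) = t.
  by rewrite /cot -[LHS]invrK invf_div -/(tan _) atanK div1r invrK.
have -> : (u < 2 / pi * atan (1 / t)) = (pi * u / 2 < atan (1 / t)).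
  rewrite [in RHS]ltr_pdivrMr// mulrAC (mulrC 2) ltr_pdivlMr ?pi_gt0//.
  by rewrite (mulrC u).
apply/idP/idP => h; last by rewrite -[ltLHS]ct; exact: cot_decr.
rewrite ltNge; apply/negP; rewrite le_eqVlt => /orP[/eqP e|lt].
  by move: h; rewrite -e ct ltxx.
by have := lt_trans h (cot_decr y0 lt xpi); rewrite ct ltxx.
Qed.

(** On []0, 1]] the event is [u < v] with [v = 2 / pi * atan (1 / t) < 1], so its uniform mass is
    [v]. Hence one active coordinate yields exactly the Half-Cauchy tail. *)
Lemma uniform_cot_tail (R : realType) d (T : measurableType d) (P : probability T R)
    (V : {RV P >-> R}) (t : R) : has_law V (uniform_prob (@ltr01 R)) -> 0 < t ->
  P [set o | t < cot (pi * V o / 2)] = (2 / pi * atan (1 / t))%:E.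
Proof.
move=> Vlaw t0.
have c0 : 0 < (2 / pi : R) by rewrite divr_gt0 ?pi_gt0.
have y0 : 0 < atan (1 / t) by rewrite -(atan0 R) lt_atan// divr_gt0.
set v := 2 / pi * atan (1 / t).
have v0 : 0 < v by exact: mulr_gt0.
have v1 : v < 1.
  have e : 2 / pi * (pi / 2) = 1 :> R by rewrite mulrA divfK ?mulfV// gt_eqF// pi_gt0.
  by have := atan_ltpi2 (1 / t); rewrite -(ltr_pM2l c0) e.
pose B := [set u : R | t < cot (pi * u / 2)].
have mB : measurable B.
  have -> : B = (fun u : R => cot (pi * u / 2)) @^-1` `]t, +oo[.
    by apply/seteqP; split => u /=; rewrite in_itv/= andbT.
  by rewrite -[X in measurable X]setTI; apply: measurable_cot_half.
have -> : P [set o | t < cot (pi * V o / 2)] = distribution P V B by [].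
rewrite Vlaw// /uniform_prob integral_uniform_pdf.
have -> : B `&` `[0, 1]%classic = `]0, v[%classic.
  apply/seteqP; split => u /=; rewrite !in_itv/=.
    move=> [Bu /andP[u0 u1]].
    (* The origin is excluded because [cot 0 = 1 / 0 = 0]. *)
    have u0' : 0 < u.
      rewrite lt_neqAle u0 andbT; apply/eqP => e; move: Bu.
      by rewrite /B /= -e mulr0 mul0r /cot sin0 invr0 mulr0 => /(lt_trans t0); rewrite ltxx.
    by rewrite u0' /=; rewrite -cot_gtE ?u0'.
  move=> /andP[u0 uv]; have u1 : u <= 1 by rewrite ltW// (lt_trans uv).
  by rewrite (ltW u0) u1; split=> //; rewrite /B/= cot_gtE// u0.
rewrite (eq_integral (cst 1%E)); last first.
  move=> y; rewrite inE/= in_itv/= /uniform_pdf => /andP[y0' yv].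
  by rewrite (ltW y0') (ltW (lt_trans yv v1)) /= subr0 invr1.
by rewrite integral_cst//= mul1e lebesgue_measure_itv/= lte_fin v0 oppr0 adde0.
Qed.

(** The tail is [coef_c] times the arctangent at [1 / t], so [atan_taylor3] leaves a remainder of at
    most [coef_c * t ^- 5]. *)
Lemma half_cauchy_expansion (R : realType) d (T : measurableType d) (P : probability T R)
    (H : {RV P >-> R}) : half_cauchy H ->
  forall t : R, rv_tail H t =
    (coef_c / t - coef_c / (3 * t ^+ 3)) +O_(t \near +oo) (t ^- 5).
Proof.
move=> Hlaw.
suff E : rv_tail H = (fun t => coef_c / t - coef_c / (3 * t ^+ 3))
    +O_ (nbhs +oo) (fun t => t ^- 5) by move=> t; exact: (congr1 (@^~ t) E).
have c0 : 0 <= (coef_c : R) by rewrite ltW// divr_gt0 ?pi_gt0.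
apply/eqaddOP; near=> k; near=> t.
have t0 : 0 < t by near: t; exact: nbhs_pinfty_gt.
have -> : (rv_tail H - (fun t => coef_c / t - coef_c / (3 * t ^+ 3))) t =
    coef_c * (atan (1 / t) - (1 / t - (1 / t) ^+ 3 / 3)).
  have -> : (rv_tail H - (fun t => coef_c / t - coef_c / (3 * t ^+ 3))) t =
    rv_tail H t - (coef_c / t - coef_c / (3 * t ^+ 3)) by [].
  rewrite /rv_tail Hlaw// div1r exprVn mulrBr mulrBr; congr (_ - (_ - _)).
  by rewrite invfM (mulrC 3^-1).
rewrite normrM (ger0_norm c0) (ger0_norm (x := t ^- 5)) ?invr_ge0 ?exprn_ge0 ?(ltW t0)//.
have i0 : 0 <= 1 / t by rewrite divr_ge0// ltW.
have h := atan_taylor3 i0.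
rewrite (le_trans (ler_wpM2l c0 h))// div1r exprVn ler_wpM2r ?invr_ge0 ?exprn_ge0 ?(ltW t0)//.
Unshelve. all: by end_near. Qed.

Section OneActiveCoordinate.
Context {R : realType} (m : nat) (theta : R) (w : 'I_m -> R).
Context dE (TE : measurableType dE) (PE : probability TE R).
Variable E : 'I_m -> {RV PE >-> R}.
Hypotheses (theta_gt0 : 0 < theta) (w_simplex : simplex w).
Hypothesis E_iid : iid_exp1 E.
Variable i0 : 'I_m.
Hypothesis one_active : forall f : 'I_m -> R, \sum_i w i * f i = f i0.
Local Notation p := (1 / theta).

Let E_exp := E_iid.2.
Let p_gt0 : 0 < p. Proof. exact: divr_gt0. Qed.
Let pN1 : -1 < p. Proof. by rewrite (lt_trans _ p_gt0)// ltrN10. Qed.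

Let one_active_powR o q : \sum_i w i * E i o `^ q = E i0 o `^ q.
Proof. exact: (one_active (fun i => E i o `^ q)). Qed.

(** Here [A ^ theta] is almost surely [E] itself, so the integrand is [p E ^ p - b E ^ (p + 1)]. Its
    mean vanishes because [Gamma (2 + p) = (1 + p) Gamma (1 + p)] and [b (1 + p) = p]. *)
Lemma one_active_D : D_w theta w E = 0.
Proof.
rewrite /D_w expectation.unlock.
have iD := integrable_D_integrand theta_gt0 w_simplex E_iid.
have p1 : -1 < p + 1 by rewrite (lt_trans pN1)// ltrDl.
have i1 := integrableZl measurableT p (integrable_exp_powR E_exp i0 pN1).
have i2 := integrableZl measurableT (coef_b theta) (integrable_exp_powR E_exp i0 p1).
rewrite (@ae_eq_integral _ _ _ PE setT (fun o => p%:E * (E i0 o `^ p)%:E -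
    (coef_b theta)%:E * (E i0 o `^ (p + 1))%:E)%E)//; last 3 first.
- by have /integrableP[] := iD.
- by have /integrableP[] := integrableB measurableT i1 i2.
- apply: filterS (iid_exp1_gt0 E_exp) => o E0 _.
  rewrite (D_integrandE E theta_gt0 w_simplex).
  rewrite (one_active_powR o p : power_mean theta w (fun i => E i o) = _).
  rewrite (one_active_powR o (p - 1) : power_mean_deriv theta w (fun i => E i o) = _).
  have e0 := E0 i0; have e0' := ltW e0.
  have -> : (E i0 o `^ p) `^ theta = E i0 o by exact: powRVK.
  have -> : (E i0 o `^ p) `^ (theta + 1) = E i0 o `^ (p + 1).
    by rewrite -powRrM mulrDr mulr1 mul1r mulVf ?gt_eqF// addrC.
  by rewrite mulr_powRB1// EFinB !EFinM.
rewrite integralB// !integralZl//; last 2 first.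
- exact: integrable_exp_powR.
- exact: integrable_exp_powR.
rewrite !(exp_law_moment (E_exp i0)) exp_momentS// GammaE// -!EFinM -EFinB /=.
have -> : coef_b theta * ((p + 1) * Gamma (1 + p)) = p * Gamma (1 + p).
  rewrite mulrA; congr (_ * _); rewrite /coef_b.
  by field; rewrite !gt_eqF// addr_gt0.
by rewrite subrr mulr0.
Qed.

(** With a single term [Q = 1 / A] almost surely, so [A ^ 2 Q = A] has mean [1 / a]; what remains is
    [d c ^ 2 = c / 3], which matches the cubic coefficient of the univariate expansion. *)
Lemma one_active_A2Q : 2 <= theta ->
  coef_a theta * coef_d * coef_c ^+ 2 * fine ('E_PE[A2Q theta w E])%E = coef_c / 3.
Proof.
move=> t2; rewrite expectation.unlock.
have iA := integrable_A2Q theta_gt0 w_simplex E_iid t2.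
have i1 := integrable_exp_powR E_exp i0 pN1.
rewrite (@ae_eq_integral _ _ _ PE setT (fun o => (E i0 o `^ p)%:E))//; last 3 first.
- by have /integrableP[] := iA.
- by have /integrableP[] := i1.
- apply: filterS (iid_exp1_gt0 E_exp) => o E0 _.
  rewrite /A2Q /A_w /Q_w !one_active_powR powRN expr2 -mulrA mulfV ?mulr1//.
  by rewrite gt_eqF// powR_gt0.
rewrite (exp_law_moment (E_exp i0)) GammaE//=.
rewrite mulrAC (mulrAC (coef_a _)) coef_aGamma// mul1r.
rewrite /coef_c /coef_d; have pi0 : (pi : R) != 0 by rewrite gt_eqF// pi_gt0.
by move: (pi : R) pi0 => x x0; field.
Qed.

End OneActiveCoordinate.

Theorem mainTheorem13 (R : realType) (m : nat) (theta : R) (w : 'I_m -> R)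
  (theta_gt0 : 0 < theta) (w_simplex : simplex w)
  (* the Clayton vector U *)
  (dU : measure_display) (TU : measurableType dU) (PU : probability TU R)
  (U : 'I_m -> {RV PU >-> R})
  (U_unif : forall i, has_law (U i) (uniform_prob (@ltr01 R)))
  (U_clayton : has_copula U (@clayton R theta m))
  (* the i.i.d. exponentials *)
  (dE : measure_display) (TE : measurableType dE) (PE : probability TE R)
  (E : 'I_m -> {RV PE >-> R})
  (E_iid : iid_exp1 E) :
  let c : R := coef_c in
  let d : R := coef_d in
  let a : R := coef_a theta in
  let D : R := D_w theta w E in
  let EA2Q : R := fine ('E_PE[A2Q theta w E])%E in
  [/\ (* the expectation defining D exists *)
      PE.-integrable setT (EFin \o D_integrand theta w E),
      (* the moment E(A^2 Q) is finite *)
      (2 <= theta -> ('E_PE[A2Q theta w E])%E \is a fin_num),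
      (* the tail expansion *)
      [/\ (theta < 2 ->
             forall t : R, sum_tail w U t =
               (c / t + c `^ (1 + theta) * D * t `^ (- 1 - theta))
               +o_(t \near +oo) (t `^ (- 1 - theta))),
          (theta = 2 ->
             forall t : R, sum_tail w U t =
               (c / t + (c ^+ 3 * D - a * d * c ^+ 2 * EA2Q) * t ^- 3)
               +o_(t \near +oo) (t ^- 3)) &
          (2 < theta ->
             forall t : R, sum_tail w U t =
               (c / t + (- a * d * c ^+ 2 * EA2Q) * t ^- 3)
               +o_(t \near +oo) (t ^- 3))] &
      (* one active coordinate *)
      (#|[pred i | w i != 0]| = 1%N ->
       [/\ D = 0,
           (2 <= theta -> a * d * c ^+ 2 * EA2Q = c / 3) &
           forall (dH : measure_display) (TH : measurableType dH)
             (PH : probability TH R) (H : {RV PH >-> R}),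
             half_cauchy H ->
             (forall t, 0 < t -> sum_tail w U t = rv_tail H t) /\
             (forall t : R, rv_tail H t =
               (c / t - c / (3 * t ^+ 3))
               +O_(t \near +oo) (t ^- 5))])].
Proof.
move=> c d a D EA2Q; split.
- exact: integrable_D_integrand.
- move=> t2; rewrite expectation.unlock.
  exact: (integrable_fin_num measurableT (integrable_A2Q theta_gt0 w_simplex E_iid t2)).
- split.
  + exact: (expansion_lt2 theta_gt0 w_simplex U_unif U_clayton E_iid).
  + exact: (expansion_eq2 theta_gt0 w_simplex U_unif U_clayton E_iid).
  + exact: (expansion_gt2 theta_gt0 w_simplex U_unif U_clayton E_iid).
- move=> /(one_active_sum w_simplex)[i0 wE]; split.
  + exact: (one_active_D theta_gt0 w_simplex E_iid wE).
  + exact: (one_active_A2Q theta_gt0 w_simplex E_iid wE).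
  + move=> dH TH PH H H_law; split; last exact: half_cauchy_expansion.
    move=> t t0; rewrite /rv_tail H_law// -(uniform_cot_tail (U_unif i0) t0).
    congr (fine (PU _)); apply/funext => o /=.
    by rewrite (wE (fun i => cot (pi * U i o / 2))).
Qed.
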